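(* Let $0<\alpha,\beta<1$ and $n\in\mathbb{N}$. For every $f\in\mathcal{D}_{\max}^{n}$ and every $s=1,\dots,n$, the $(2n-s)$-th quasi-derivative of $f$ at $x=1$ and $x=-1$ is generated by $\varphi_s^+$ and $\varphi_s^-$, respectively. Explicitly, $$f^{[2n-s]}(1)=\frac{(-1)^s}{(s-1)!}[f,\varphi_s^+]_n(1),\qquad -f^{[2n-s]}(-1)=\frac{1}{(s-1)!}[f,\varphi_s^-]_n(-1).$$
   Context: Fix $0<\alpha,\beta<1$ and $n\in\mathbb{N}$. Let $L^2_{\alpha,\beta}:=L^2\big((-1,1),(1-x)^\alpha(1+x)^\beta dx\big)$. The Jacobi expression is $\ell[f](x)=-\frac{1}{(1-x)^{\alpha}(1+x)^{\beta}}\big[(1-x)^{\alpha+1}(1+x)^{\beta+1}f'(x)\big]'$, and $\ell^n$ is its $n$-fold composition. It can be written as $\ell^n[f]=\frac{1}{(1-x)^{\alpha}(1+x)^{\beta}}\sum_{k=1}^n(-1)^k\big[a_kf^{(k)}\big]^{(k)}$ with $a_k(x)=C(n,k,\alpha,\beta)(1-x)^{\alpha+k}(1+x)^{\beta+k}$, where the real constants $C(n,k,\alpha,\beta)$ are determined by this identity. Maximal domain: $\mathcal{D}_{\max}^{n}=\{f\in L^2_{\alpha,\beta}: f,f',\dots,f^{(2n-1)}\in AC_{\rm loc}(-1,1),\ \ell^n[f]\in L^2_{\alpha,\beta}\}$. Sesquilinear form: for $f,g\in\mathcal{D}^n_{\max}$ and $x\in(-1,1)$, $$[f,g]_n(x)=\sum_{k=1}^n\sum_{j=1}^k(-1)^{k+j}\Big\{\big[a_k\overline{g}^{(k)}\big]^{(k-j)}(x)f^{(j-1)}(x)-\big[a_kf^{(k)}\big]^{(k-j)}(x)\overline{g}^{(j-1)}(x)\Big\},$$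 and $[f,g]_n(\pm1):=\lim_{x\to\pm1^{\mp}}[f,g]_n(x)$; these limits exist and are finite. Quasi-derivatives: $f^{[0]}=f$, $f^{[k]}=f^{(k)}$ for $1\le k\le n-1$, $f^{[n]}=a_nf^{(n)}$, $f^{[n+k]}=a_{n-k}f^{(n-k)}-\big[f^{[n+k-1]}\big]'$ for $1\le k\le n-1$. For $n\le m\le 2n-1$, $f^{[m]}(\pm1)$ denotes the limit as $x\to\pm1^{\mp}$. For $j\in\mathbb{N}$, $\varphi_j^{\pm}$ are fixed $C^\infty(-1,1)$ functions with $\varphi_j^+(x)=(1-x)^{j-1}$ for $x$ near $1$ and $0$ for $x$ near $-1$; $\varphi_j^-(x)=(1+x)^{j-1}$ for $x$ near $-1$ and $0$ for $x$ near $1$. They belong to $\mathcal{D}_{\max}^n$. *)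

(* Defs.v *)
From HB Require Import structures.
From mathcomp Require Import all_boot all_order all_algebra.
From mathcomp Require Import all_classical all_reals all_analysis.
From mathcomp Require Import complex.
Set Implicit Arguments.
Unset Strict Implicit.
Unset Printing Implicit Defensive.
Import Order.TTheory GRing.Theory Num.Theory numFieldNormedType.Exports.
Local Open Scope classical_set_scope.
Local Open Scope ring_scope.
Local Open Scope complex_scope.

Section complex_valued_functions.
Context {R : realType}.
Implicit Types (f g : R -> R[i]) (x : R).

(* The library has no normed R-module structure on R[i], so a function of a
   real variable with values in R[i] is differentiated componentwise. *)
Definition cderivable f x : Prop :=
  derivable (@complex.Re R \o f) x 1 /\ derivable (@complex.Im R \o f) x 1.

Definition cderiv f : R -> R[i] := fun x =>
  derive1 (@complex.Re R \o f) x +i* derive1 (@complex.Im R \o f) x.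

Definition cderivn (k : nat) f : R -> R[i] := iter k cderiv f.

Definition cmod (z : R[i]) : R := complex.Re `|z|.

Definition AC_on (a b : R) f : Prop :=
  forall e : R, 0 < e -> exists2 d : R, 0 < d &
    forall (m : nat) (u v : nat -> R),
      (forall i, (i < m)%N -> a <= u i /\ u i <= v i /\ v i <= b) ->
      (forall i j, (i < m)%N -> (j < m)%N -> i <> j ->
         v i <= u j \/ v j <= u i) ->
      \sum_(i < m) (v i - u i) < d ->
      \sum_(i < m) cmod (f (v i) - f (u i)) < e.

Definition ACloc f : Prop :=
  forall a b : R, -1 < a -> a <= b -> b < 1 -> AC_on a b f.

Definition smooth f : Prop :=
  forall (k : nat) x, -1 < x < 1 -> cderivable (cderivn k f) x.

(* One-sided limits at the endpoints of (-1,1), in the topology of the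
   numeric field R[i]; R[i]^o is R[i] as a normed module over itself. *)
Definition cvg_right f : Prop := cvg ((f x : R[i]^o) @[x --> (1 : R)^'-]).
Definition cvg_left f : Prop := cvg ((f x : R[i]^o) @[x --> (-1 : R)^'+]).
Definition lim_right f : R[i] := lim ((f x : R[i]^o) @[x --> (1 : R)^'-]).
Definition lim_left f : R[i] := lim ((f x : R[i]^o) @[x --> (-1 : R)^'+]).

End complex_valued_functions.

Section jacobi.
Context {R : realType} (alpha beta : R).
Implicit Types (f g phi : R -> R[i]) (C : nat -> R).

Definition jweight (x : R) : R := (1 - x) `^ alpha * (1 + x) `^ beta.

Definition L2 f : Prop :=
  [/\ measurable_fun `](-1 : R), 1[ (@complex.Re R \o f),
      measurable_fun `](-1 : R), 1[ (@complex.Im R \o f) &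
      (\int[@lebesgue_measure R]_(x in `](-1)%R, 1%R[)
         (cmod (f x) ^+ 2 * jweight x)%:E < +oo)%E].

Definition jacobi_expr f : R -> R[i] := fun x =>
  - ((jweight x)^-1)%:C *
  cderiv (fun y =>
    ((1 - y) `^ (alpha + 1) * (1 + y) `^ (beta + 1))%:C * cderiv f y) x.

Definition jacobi_pow (n : nat) f : R -> R[i] := iter n jacobi_expr f.

Definition acoef C (k : nat) (x : R) : R :=
  C k * (1 - x) `^ (alpha + k%:R) * (1 + x) `^ (beta + k%:R).

(* The identity that determines the constants C(n,k,alpha,beta), 1 <= k <= n,
   at every point where f is 2n times differentiable. *)
Definition jacobi_constants (n : nat) C : Prop :=
  forall f x, -1 < x < 1 ->
    (forall k y, (k.+1 < n.*2)%N -> -1 < y < 1 -> cderivable (cderivn k f) y) ->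
    cderivable (cderivn (n.*2).-1 f) x ->
    jacobi_pow n f x =
      ((jweight x)^-1)%:C *
      \sum_(1 <= k < n.+1) (-1) ^+ k *
        cderivn k (fun y => (acoef C k y)%:C * cderivn k f y) x.

(* Differentiability is spelled out since cderiv is a total operator. *)
Definition Dmax (n : nat) f : Prop :=
  [/\ L2 f,
      forall k x, (k.+1 < n.*2)%N -> -1 < x < 1 -> cderivable (cderivn k f) x,
      forall k, (k < n.*2)%N -> ACloc (cderivn k f) &
      L2 (jacobi_pow n f)].

Definition sesq (n : nat) C f g : R -> R[i] := fun x =>
  let gbar := fun y => (g y)^* in
  \sum_(1 <= k < n.+1) \sum_(1 <= j < k.+1) (-1) ^+ (k + j) *
    (cderivn (k - j) (fun y => (acoef C k y)%:C * cderivn k gbar y) x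
       * cderivn j.-1 f x
     - cderivn (k - j) (fun y => (acoef C k y)%:C * cderivn k f y) x
       * cderivn j.-1 gbar x).

(* quasi_upper n C f k is the quasi-derivative of order n + k. *)
Fixpoint quasi_upper (n : nat) C f (k : nat) : R -> R[i] :=
  match k with
  | 0 => fun x => (acoef C n x)%:C * cderivn n f x
  | k'.+1 => fun x =>
      (acoef C (n - k) x)%:C * cderivn (n - k) f x
      - cderiv (quasi_upper n C f k') x
  end.

Definition quasi (n : nat) C f (m : nat) : R -> R[i] :=
  if (m < n)%N then cderivn m f else quasi_upper n C f (m - n).

Definition phi_right (j : nat) phi : Prop :=
  [/\ smooth phi,
      \forall x \near (1 : R)^'-, phi x = ((1 - x) ^+ j.-1)%:C &
      \forall x \near (-1 : R)^'+, phi x = 0].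

Definition phi_left (j : nat) phi : Prop :=
  [/\ smooth phi,
      \forall x \near (-1 : R)^'+, phi x = ((1 + x) ^+ j.-1)%:C &
      \forall x \near (1 : R)^'-, phi x = 0].

End jacobi.

(* Main.v *)
Require Import Defs.
From HB Require Import structures.
From mathcomp Require Import all_boot all_order all_algebra.
From mathcomp Require Import all_classical all_reals all_analysis.
From mathcomp Require Import complex.
From mathcomp Require Import measurable_realfun zify ring lra.
Set Implicit Arguments.
Unset Strict Implicit.
Unset Printing Implicit Defensive.
Import Order.TTheory GRing.Theory Num.Theory numFieldNormedType.Exports.
Local Open Scope classical_set_scope.
Local Open Scope ring_scope.

(** Real and imaginary parts are treated separately. An absolutely continuous
    real function is the primitive of its almost everywhere derivative
    (Radon-Nikodym for the Stieltjes measure of its total variation, then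
    Lebesgue differentiation). With w the Jacobi weight, the functions
    (1-x)^(alpha+1) (1+x)^(beta+1) (l^(n-1)[f])' and f^[2n-1] both have derivative
    -w l^n[f] almost everywhere; it is integrable because l^n[f] is in L^2, so both
    functions have limits at -1 and 1. Integrating l[.] back n times from the first
    limit gives f^(k) = O((1-x)^(-alpha-k)) at 1 for k <= 2n-1, hence a_k f^(k) = O(1).
    Since (f^[2n-s-1])' = a_s f^(s) - f^[2n-s], the limits of the other
    quasi-derivatives follow by induction on s. Finally
    [f,g]_n = sum_j (f^(j-1) g^[2n-j] - f^[2n-j] g^(j-1)), and for g = (1-x)^(s-1) every
    summand tends to 0 except the one with f^[2n-s] g^(s-1). The endpoint -1 is
    reduced to 1 by x -> -x, which exchanges alpha and beta. *)

(** * Absolutely continuous functions *)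

Section absolute_continuity.
Context {R : realType}.
Implicit Types (a b x y : R) (G N : R -> R) (s t : seq (R * R)).
Local Notation mu := (@lebesgue_measure R).
Local Notation TV := total_variation.

(** The function f^(2n-1) is known to be locally absolutely continuous, so the identity that fixes
    the constants is available only almost everywhere, at the points where f^(2n-1) is
    differentiable. Boundary values therefore come from integration. The function w l^n[f] is
    integrable because w is bounded and t <= 1 + t^2. The bounds on f^(k) are taken from the nested
    form of l^n, which inverts by dividing by explicit powers and integrating; the sum form would
    require dividing by constants known only through an identity. The exponent -alpha is stable
    under this inversion: a flux O(1) gives u' = O((1-x)^(-alpha-1)), then u = O((1-x)^(-alpha)) as
    alpha > 0, and w u = O(1) makes the next flux O(1) again. These bounds are critical: they give
    a_k f^(k) = O(1) and nothing that tends to 0. The decay in the form comes from (1-x)^(s-1) being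
    a polynomial of degree s-1: its k-th derivative is 0 for k >= s and leaves a surplus factor
    (1-x)^(s-k) for k < s. *)

Definition nonoverlapping (p q : R * R) : bool := (p.2 <= q.1) || (q.2 <= p.1).

(** An unordered list: replacing one interval by a partition of it is then a mere concatenation,
    with no sorting. *)
Definition itv_family a b s : bool :=
  all (fun p => (a <= p.1) && (p.1 <= p.2) && (p.2 <= b)) s
  && pairwise nonoverlapping s.

Definition abs_cont a b G : Prop := forall e, 0 < e -> exists2 d, 0 < d &
  forall s, itv_family a b s -> \sum_(p <- s) (p.2 - p.1) < d ->
    \sum_(p <- s) `|G p.2 - G p.1| < e.

Lemma nonoverlappingC : symmetric nonoverlapping.
Proof. by move=> p q; rewrite /nonoverlapping orbC. Qed.

Lemma itv_family_cat a b s t : itv_family a b (s ++ t) =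
  [&& itv_family a b s, itv_family a b t & allrel nonoverlapping s t].
Proof.
rewrite /itv_family all_cat pairwise_cat.
by do ![case: (all _ _) => //=|case: (pairwise _ _) => //=|case: (allrel _ _ _)=> //=].
Qed.

Definition partition_pairs x (l : seq R) : seq (R * R) := zip (x :: l) l.

Lemma itv_family_partition x y (l : seq R) : itv_partition x y l ->
  itv_family x y (partition_pairs x l).
Proof.
rewrite /partition_pairs.
elim: l x => [|z l IH] x; first by [].
move=> xl; have := itv_partition_cons xl => zl.
have xz : x < z by case: xl => /= /andP[].
have zy := itv_partition_le zl.
have := IH z zl; rewrite /itv_family /= => /andP[al pw].
rewrite lexx (ltW xz) zy/= pw andbT; apply/andP; split.
  apply: sub_all al => p /andP[/andP[h1 h2] h3].
  by rewrite h2 h3 (le_trans (ltW xz) h1).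
apply: sub_all al => p /andP[/andP[h1 h2] h3].
by rewrite /nonoverlapping/= h1.
Qed.

Lemma sum_partition_pairs x y (l : seq R) : itv_partition x y l ->
  \sum_(p <- partition_pairs x l) (p.2 - p.1) = y - x.
Proof.
rewrite /partition_pairs.
elim: l x => [|z l IH] x xl.
  by rewrite big_nil (itv_partition_nil xl) subrr.
rewrite /= big_cons -[zip _ _]/(zip (z :: l) l) (IH z (itv_partition_cons xl)).
by rewrite /= addrC addrA subrK.
Qed.

Lemma variation_partition_pairs x y G (l : seq R) : itv_partition x y l ->
  variation x y G l = \sum_(p <- partition_pairs x l) `|G p.2 - G p.1|.
Proof.
move=> xl; rewrite variation_zip// /partition_pairs.
elim: l x {xl} => [|z l IH] x; first by rewrite /= !big_nil.
by rewrite /= !big_cons; congr (_ + _); rewrite IH.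
Qed.

Lemma nonoverlapping_sub p q r : p.1 <= q.1 -> q.2 <= p.2 ->
  nonoverlapping p r -> nonoverlapping q r.
Proof.
move=> pq qp /orP[pr|rp]; apply/orP; [left|right].
  exact: le_trans pr.
exact: le_trans pq.
Qed.

(** Induction on [t]: its first interval is replaced by an arbitrary partition, whose pieces join
    [s] without changing the total length; the supremum over the partitions then turns increments
    into a total variation. *)
Lemma total_variation_family a b G e d :
  (forall s, itv_family a b s -> \sum_(p <- s) (p.2 - p.1) < d ->
    \sum_(p <- s) `|G p.2 - G p.1| < e) ->
  forall s t, itv_family a b (s ++ t) -> \sum_(p <- s ++ t) (p.2 - p.1) < d ->
  ((\sum_(p <- s) `|G p.2 - G p.1|)%:E +
   \sum_(p <- t) total_variation p.1 p.2 G <= e%:E)%E.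
Proof.
move=> H s t; elim: t s => [|[u v] t IH] s st sumst.
  by rewrite big_nil adde0 lee_fin ltW// H// -(cats0 s).
rewrite big_cons/=.
move: (st); rewrite itv_family_cat => /and3P[fs].
rewrite /itv_family /= => /andP[/andP[/andP[/andP[au uv] vb] at_] /andP[puv pt]] rst.
have key l : itv_partition u v l ->
  ((\sum_(p <- s) `|G p.2 - G p.1|)%:E + ((variation u v G l)%:E +
    \sum_(p <- t) total_variation p.1 p.2 G) <= e%:E)%E.
  move=> uvl; rewrite addeA -EFinD (variation_partition_pairs _ uvl) -big_cat.
  apply: IH; last first.
    move: sumst; rewrite !big_cat/= big_cons/= (sum_partition_pairs uvl).
    by rewrite addrA.
  have /andP[al pl] := itv_family_partition uvl.
  have alP p : p \in partition_pairs u l -> u <= p.1 /\ p.2 <= v.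
    by move=> /(allP al)/= /andP[/andP[-> _] ->].
  have sr : allrel nonoverlapping s (partition_pairs u l).
    apply/allrelP => p q ps /alP[q1 q2]; rewrite nonoverlappingC.
    apply: (@nonoverlapping_sub (u, v)) => //; rewrite nonoverlappingC.
    by move/allrelP : rst; apply=> //; rewrite inE eqxx.
  have rt : allrel nonoverlapping (partition_pairs u l) t.
    apply/allrelP => q p /alP[q1 q2] pt'.
    apply: (@nonoverlapping_sub (u, v)) => //.
    exact: (allP puv).
  rewrite !itv_family_cat fs/= allrel_catl sr rt /= /itv_family pl at_ pt /= !andbT.
  apply/andP; split.
    apply/allP => p /(allP al)/= /andP[/andP[h1 h2] h3].
    by rewrite (le_trans au h1) h2 (le_trans h3 vb).
  by move: rst; rewrite allrel_consr => /andP[].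
(* Finiteness allows the remaining sum to be moved across the inequality in the extended reals; it
   follows from the induction hypothesis for the family without [(u, v)]. *)
have fin : ((\sum_(p <- t) total_variation p.1 p.2 G) \is a fin_num)%E.
  have := IH s; have -> : itv_family a b (s ++ t).
    rewrite itv_family_cat fs /itv_family at_ pt /=.
    by move: rst; rewrite allrel_consr => /andP[].
  move=> /(_ erefl); rewrite big_cat/=.
  have -> : \sum_(p <- s) (p.2 - p.1) + \sum_(p <- t) (p.2 - p.1) < d.
    apply: le_lt_trans sumst; rewrite big_cat/= big_cons/= lerD2l.
    by rewrite lerDr subr_ge0.
  move=> /(_ erefl) le_e.
  rewrite ge0_fin_numE; last first.
    rewrite big_seq; apply: sume_ge0 => p pt'; apply: total_variation_ge0.
    by move/allP : at_ => /(_ p pt') /andP[/andP[]].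
  rewrite -(@lteD2lE _ (\sum_(p <- s) `|G p.2 - G p.1|)%:E)// addey//.
  by rewrite (le_lt_trans le_e)// ltry.
rewrite addeCA -leeBrDr; last by rewrite fin_numD fin fin_numE.
apply: ge_ereal_sup => _ [_ [l uvl <-] <-].
rewrite leeBrDr; last by rewrite fin_numD fin fin_numE.
by rewrite addeCA; exact: key.
Qed.

Lemma itv_family1 a b x y : itv_family a b [:: (x, y)] = (a <= x <= y) && (y <= b).
Proof. by rewrite /itv_family/= !andbT. Qed.

(** With tolerance 1, a piece of length less than [d] has variation at most 1, and finitely many
    steps of length [d / 2] reach any point of the interval. *)
Lemma abs_cont_total_variation_lty a b G : abs_cont a b G ->
  forall x, a <= x <= b -> (TV a x G < +oo)%E.
Proof.
move=> /(_ 1 ltr01)[d d0 Hd].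
have short u v : a <= u -> u <= v -> v <= b -> v - u < d -> (TV u v G <= 1%:E)%E.
  move=> au uv vb uvd.
  have := @total_variation_family a b G 1 d Hd [::] [:: (u, v)].
  rewrite /= itv_family1 !big_cons !big_nil/= au uv vb adde0 add0e addr0.
  by apply.
have main (k : nat) : forall x, a <= x <= b -> x - a <= k%:R * (d / 2) ->
    (TV a x G < +oo)%E.
  elim: k => [|k IH] x /andP[ax xb].
    rewrite mul0r subr_le0 => xa.
    have -> : x = a by apply/eqP; rewrite eq_le ax xa.
    by rewrite total_variationxx.
  move=> xk; pose c := Num.max a (x - d / 2).
  have ac : a <= c by rewrite le_max lexx.
  have cx : c <= x by rewrite ge_max ax/= gerBl divr_ge0// ltW.
  rewrite (total_variationD _ ac cx); apply: lte_add_pinfty.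
    apply: IH; first by rewrite ac (le_trans cx).
    rewrite /c; have [_|_] := leP a (x - d / 2).
      by move: xk; rewrite -natr1 mulrDl mul1r; lra.
    by rewrite subrr mulr_ge0// divr_ge0// ltW.
  apply: (@le_lt_trans _ _ 1%:E); last by rewrite ltry.
  apply: short => //; rewrite /c.
  have : x - d / 2 <= Num.max a (x - d / 2) by rewrite le_max lexx orbT.
  by move: (Num.max _ _) => z; lra.
move=> x xab; have d20 : 0 < d / 2 by rewrite divr_gt0.
apply: (main (Num.bound ((x - a) / (d / 2))) _ xab).
rewrite -ler_pdivrMr//; apply/ltW/archi_boundP.
by rewrite divr_ge0 ?subr_ge0 ?(ltW d20)//; case/andP: xab.
Qed.

Lemma abs_cont_variation a b G : abs_cont a b G ->
  abs_cont a b (fun x => fine (TV a x G)).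
Proof.
move=> acG; have fin := abs_cont_total_variation_lty acG.
(* The supremum over partitions weakens [<] to [<=], hence the tolerance [e / 2]. *)
move=> e e0; have e20 : 0 < e / 2 by rewrite divr_gt0.
have [d d0 Hd] := acG _ e20; exists d => // s fs ss.
have := @total_variation_family a b G _ _ Hd [::] s fs ss.
rewrite big_nil add0e => H.
suff E : ((\sum_(p <- s) `|fine (TV a p.2 G) - fine (TV a p.1 G)|)%:E =
    \sum_(p <- s) TV p.1 p.2 G)%E.
  have : ((\sum_(p <- s) `|fine (TV a p.2 G) - fine (TV a p.1 G)|)%:E <= (e / 2)%:E)%E.
    by rewrite E.
  by rewrite lee_fin => /le_lt_trans; apply; lra.
rewrite -sumEFin big_seq [RHS]big_seq; apply: eq_bigr => p ps.
have /andP[/allP/(_ _ ps)/andP[/andP[ap pp] pb] _] := fs.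
have := fin p.2; rewrite (le_trans ap pp) pb => /(_ isT).
rewrite (total_variationD G ap pp) => fin2.
have T1 : (0 <= TV a p.1 G)%E by exact: total_variation_ge0.
have T2 : (0 <= TV p.1 p.2 G)%E by exact: total_variation_ge0.
have F1 : TV a p.1 G \is a fin_num.
  by rewrite ge0_fin_numE// (le_lt_trans _ fin2)// leeDl.
have F2 : TV p.1 p.2 G \is a fin_num.
  by rewrite ge0_fin_numE// (le_lt_trans _ fin2)// leeDr.
rewrite fineD// addrAC subrr add0r ger0_norm ?fineK//.
exact: fine_ge0.
Qed.

Lemma abs_contD a b G N : abs_cont a b G -> abs_cont a b N ->
  abs_cont a b (fun x => G x + N x).
Proof.
move=> acG acN e e0; have e20 : 0 < e / 2 by rewrite divr_gt0.
have [d d0 Hd] := acG _ e20; have [d' d'0 Hd'] := acN _ e20.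
exists (Num.min d d'); first by rewrite lt_min d0.
move=> s fs; rewrite lt_min => /andP[/(Hd _ fs) h /(Hd' _ fs) h'].
apply: (@le_lt_trans _ _ (\sum_(p <- s) `|G p.2 - G p.1| +
    \sum_(p <- s) `|N p.2 - N p.1|)); last by lra.
rewrite -big_split/=; apply: ler_sum => p _.
by rewrite opprD addrACA ler_normD.
Qed.

Lemma abs_contN a b G : abs_cont a b G -> abs_cont a b (fun x => - G x).
Proof.
move=> acG e /acG[d d0 Hd]; exists d => // s fs ss.
rewrite (eq_bigr (fun p => `|G p.2 - G p.1|)); first exact: Hd.
by move=> p _; rewrite opprK addrC distrC.
Qed.

(** Retraction onto [a,b], monotone and 1-Lipschitz. Composition with it extends a function
    constantly to the whole line, where a cumulative function has to be defined. *)
Definition clamp a b x := Num.max a (Num.min x b).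

Lemma clamp_itv a b x : a <= b -> a <= clamp a b x <= b.
Proof. by move=> ab; rewrite /clamp le_max lexx ge_max ab ge_min lexx orbT. Qed.

Lemma clamp_id a b x : a <= x <= b -> clamp a b x = x.
Proof. by move=> /andP[ax xb]; rewrite /clamp (min_idPl xb) (max_idPr ax). Qed.

Lemma clamp_le a b x y : x <= y -> clamp a b x <= clamp a b y.
Proof.
move=> xy; rewrite /clamp ge_max le_max lexx/= le_max.
by rewrite le_min !ge_min xy lexx /= orbT orbT.
Qed.

Lemma clamp_lip a b x y : x <= y -> clamp a b y - clamp a b x <= y - x.
Proof.
move=> xy; rewrite /clamp.
rewrite /Num.max /Num.min.
by repeat case: ifPn => //; rewrite -?leNgt; lra.
Qed.

Lemma abs_cont_clamp a b G a' b' : a <= b -> abs_cont a b G ->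
  abs_cont a' b' (G \o clamp a b).
Proof.
move=> ab acG e /acG[d d0 Hd]; exists d => // s /andP[fs ps] ss.
have -> : \sum_(p <- s) `|(G \o clamp a b) p.2 - (G \o clamp a b) p.1| =
  \sum_(p <- map (fun p => (clamp a b p.1, clamp a b p.2)) s) `|G p.2 - G p.1|.
  by rewrite big_map.
apply: Hd.
  apply/andP; split.
    rewrite all_map; apply: sub_all fs => p /= /andP[/andP[_ pp] _].
    have /andP[-> _] := clamp_itv p.1 ab; have /andP[_ ->] := clamp_itv p.2 ab.
    by rewrite clamp_le.
  rewrite pairwise_map; apply: sub_pairwise ps => p q /= /orP[h|h]; apply/orP.
    by left; exact: clamp_le.
  by right; exact: clamp_le.
apply: le_lt_trans ss; rewrite big_map big_seq [leRHS]big_seq.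
apply: ler_sum => p ps'; apply: clamp_lip.
by have /andP[/andP[_ ->]] := allP fs _ ps'.
Qed.

Lemma abs_cont_clamp_continuous a b G : a <= b -> abs_cont a b G ->
  continuous (G \o clamp a b).
Proof.
move=> ab acG x; apply/cvgrPdist_lt => e e0; have [d d0 Hd] := acG _ e0.
have key y z : y <= z -> `|y - z| < d ->
    `|(G \o clamp a b) z - (G \o clamp a b) y| < e.
  move=> yz yzd; have := Hd [:: (clamp a b y, clamp a b z)].
  rewrite itv_family1 !big_cons !big_nil/= !addr0; apply.
    have /andP[-> _] := clamp_itv y ab; have /andP[_ ->] := clamp_itv z ab.
    by rewrite clamp_le.
  apply: le_lt_trans yzd; apply: le_trans (clamp_lip _ _ yz) _.
  by rewrite distrC ler_norm.
near=> y.
have yd : `|x - y| < d by near: y; exact: cvgr_dist_lt.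
have [xy|/ltW yx] := leP x y; first by rewrite distrC key.
by rewrite key// distrC.
Unshelve. all: by end_near. Qed.

(** * Stieltjes measures and primitives *)

Lemma lebesgue_stieltjes_measure_oc (f : cumulative R R) x y : x <= y ->
  lebesgue_stieltjes_measure f `]x, y] = (f y - f x)%:E.
Proof.
move=> xy; rewrite /lebesgue_stieltjes_measure/= /measure_extension/=.
rewrite measurable_mu_extE/=; last exact: is_ocitv.
by rewrite wlength_itv_bnd// EFinB.
Qed.

(** The last disjunction pins an empty set to the point [a], to the left of every other interval, so
    that empty components never count as overlapping. *)
Lemma open_interval_endpoints a b (I : set R) : a < b -> open I ->
  is_interval I -> I `<=` `]a, b[ ->
  exists p : R * R, [/\ I = `]p.1, p.2[%classic, a <= p.1, p.1 <= p.2 & p.2 <= b] /\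
    (p.1 < p.2 \/ p.2 = a).
Proof.
move=> ab oI iI Iab; have [I0|/set0P[z Iz]] := eqVneq I set0.
  exists (a, a) => /=; split; last by right.
  by rewrite lexx (ltW ab) I0 set_itvoo0.
have lI : has_lbound I by exists a => y /Iab/=; rewrite in_itv/= => /andP[/ltW].
have uI : has_ubound I by exists b => y /Iab/=; rewrite in_itv/= => /andP[_ /ltW].
have IE : I = `]inf I, sup I[%classic.
  have IE : I = [set r | inf I < r < sup I].
    by rewrite -interval_bounded_interior//; exact/esym/(interior_id I).1.
  rewrite [LHS]IE; by apply/seteqP; split => y /=; rewrite in_itv.
have zlt : inf I < z < sup I by move: Iz; rewrite {1}IE/= in_itv.
exists (inf I, sup I) => /=; split; last by left; case/andP: zlt => /lt_trans h /h.
split => //.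
- apply: lb_le_inf; first by exists z.
  by move=> y /Iab/=; rewrite in_itv/= => /andP[/ltW].
- by case/andP: zlt => /lt_trans h /h /ltW.
- apply: ge_sup; first by exists z.
  by move=> y /Iab/=; rewrite in_itv/= => /andP[_ /ltW].
Qed.

(** Outer regularity encloses [A] in an open set of Lebesgue measure less than [d]. Any finitely
    many of its disjoint component intervals form an admissible family, so their Stieltjes mass
    stays below [e], and this bound passes to the limit. *)
Lemma abs_cont_lebesgue_stieltjes0 (f : cumulative R R) a b (A : set R) :
  a < b -> abs_cont a b f -> measurable A -> A `<=` `]a, b[ -> mu A = 0%E ->
  lebesgue_stieltjes_measure f A = 0%E.
Proof.
move=> ab acf mA Aab A0; apply/eqP; rewrite eq_le measure_ge0 andbT.
apply/lee_addgt0Pr => e e0; rewrite add0e.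
have [d d0 Hd] := acf _ e0.
have Afin : (mu A < +oo)%E by rewrite A0.
have [U [oU AU Ud]] := lebesgue_regularity_outer mA Afin d0.
pose U' := U `&` `]a, b[.
have oU' : open U' by apply: openI => //; exact: interval_open.
have mU' : measurable U' by exact: open_measurable.
have AU' : A `<=` U' by rewrite subsetI.
have U'd : (mu U' < d%:E)%E.
  apply: le_lt_trans Ud; rewrite -[X in (_ <= X)%E]add0e -A0 -measureU//; last 2 first.
  - by apply: measurableD => //; exact: open_measurable.
  - by rewrite setDE setIA setIAC setICr set0I.
  apply: le_measure; rewrite ?inE//.
    by apply: measurableU => //; apply: measurableD => //; exact: open_measurable.
  by move=> x [Ux _]; have [Ax|nAx] := pselect (A x); [left|right].
pose I := open_disjoint_itv oU'.
have IU' i : I i `<=` U' by rewrite (open_disjoint_itv_bigcup oU'); exact: bigcup_sup.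
have mI i : measurable (I i) by apply: open_measurable; exact: open_disjoint_itv_open.
have tI : trivIset setT I by exact: open_disjoint_itv_trivIset.
have Ip i : exists q : R * R, [/\ I i = `]q.1, q.2[%classic, a <= q.1, q.1 <= q.2 & q.2 <= b] /\
    (q.1 < q.2 \/ q.2 = a).
  apply: open_interval_endpoints => //.
  - exact: open_disjoint_itv_open.
  - exact: open_disjoint_itv_is_interval.
  - by apply: subset_trans (IU' i) _; exact: subIsetr.
have [p /all_and2[pI pa]] := choice Ip.
apply: (@le_trans _ _ (lebesgue_stieltjes_measure f U')).
  by apply: le_measure; rewrite ?inE.
rewrite {1}(open_disjoint_itv_bigcup oU') measure_bigcup//.
apply: lime_le; first exact: is_cvg_nneseries.
apply: nearW => m.
apply: (@le_trans _ _ (\sum_(0 <= i < m) (f (p i).2 - f (p i).1)%:E)%E).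
  under eq_bigl do rewrite in_setT.
  apply: lee_sum => i _.
  have [IE _ pp _] := pI i.
  rewrite -lebesgue_stieltjes_measure_oc// -/(I i) IE.
  apply: le_measure; rewrite ?inE; try exact: measurable_itv.
  by apply: subset_itvl; rewrite bnd_simp.
rewrite sumEFin lee_fin; apply: ltW.
have -> : \sum_(0 <= i < m) (f (p i).2 - f (p i).1) =
    \sum_(q <- map p (index_iota 0 m)) `|f q.2 - f q.1|.
  rewrite big_map; apply: eq_bigr => i _; rewrite ger0_norm// subr_ge0.
  by have [_ _ pp _] := pI i; apply: cumulative_is_nondecreasing.
apply: Hd.
  apply/andP; split.
    by apply/allP => q /mapP[i _ ->]; have [_ -> -> ->] := pI i.
  rewrite pairwise_map; apply/(pairwiseP 0%N) => i j.
  rewrite !inE size_iota => im jm ij; rewrite /= !nth_iota//.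
  have {}ij : (0 + i)%N <> (0 + j)%N by rewrite !add0n => E; rewrite E ltnn in ij.
  move: {im jm}(0 + i)%N (0 + j)%N ij => {}i {}j ij.
  have [Ii ai ii bi] := pI i; have [Ij aj jj bj] := pI j.
  rewrite /nonoverlapping; apply: contrapT => /negP; rewrite negb_or -!ltNge => /andP[h1 h2].
  have [hi|hi] := pa i; last by move: h1; rewrite hi ltNge aj.
  have [hj|hj] := pa j; last by move: h2; rewrite hj ltNge ai.
  (* Two overlapping nonempty components would share the midpoint of their intersection. *)
  pose lo := Num.max (p i).1 (p j).1; pose hi' := Num.min (p i).2 (p j).2.
  have lohi : lo < hi' by rewrite gt_max !lt_min hi hj h1 h2.
  have : (I i `&` I j) ((lo + hi') / 2).
    have [c1 c2] : (lo < (lo + hi') / 2 /\ (lo + hi') / 2 < hi')%R by split; lra.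
    move: c1 c2; rewrite /lo /hi' gt_max lt_min => /andP[l1 l2] /andP[l3 l4].
    by split; rewrite ?Ii ?Ij /= in_itv/= ?l1 ?l2 ?l3 ?l4.
  by move/trivIsetP : tI => /(_ i j Logic.I Logic.I); move/eqP: ij => ij /(_ ij) ->.
rewrite big_map -lte_fin -sumEFin; apply: le_lt_trans U'd.
rewrite {1}(open_disjoint_itv_bigcup oU') measure_bigcup//.
apply: (@le_trans _ _ (\sum_(0 <= i < m) mu (I i))%E); last first.
  rewrite [leLHS](eq_bigl (fun i => i \in [set: nat])); last by move=> i; rewrite in_setT.
  exact: nneseries_lim_ge.
apply: lee_sum => i _; have [IE _ pp _] := pI i.
rewrite IE lebesgue_measure_itv/= lte_fin.
by case: ltP => // h; rewrite lee_fin subr_le0.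
Unshelve. all: by move=> i _; exact: mI.
Qed.

Lemma nondecreasing_abs_cont_primitive a b N : a < b ->
  {in `[a, b] &, nondecreasing_fun N} -> abs_cont a b N ->
  exists2 g : R -> R, mu.-integrable setT (EFin \o g) &
    forall x, a <= x <= b -> N x - N a = \int[mu]_(t in `[a, x]) g t.
Proof.
move=> ab ndN acN; pose Nc := N \o clamp a b.
have Nc_nd : nondecreasing Nc.
  move=> x y xy; apply: ndN; last exact: clamp_le.
    by rewrite in_itv/= clamp_itv// ltW.
  by rewrite in_itv/= clamp_itv// ltW.
have Nc_cont := abs_cont_clamp_continuous (ltW ab) acN.
have Nc_rc : right_continuous Nc := right_continuousW Nc_cont.
pose F : cumulative R R := HB.pack Nc (isCumulative.Build R _ R Nc Nc_nd Nc_rc).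
pose M : {measure set (measurableTypeR R) -> \bar R} := lebesgue_stieltjes_measure F.
have ME x y : x <= y -> M `]x, y]%classic = (F y - F x)%:E.
  exact: lebesgue_stieltjes_measure_oc.
have mab : measurable (`]a, b]%classic : set (measurableTypeR R)) by exact: measurable_itv.
have Fab : (M `]a, b]%classic < +oo)%E.
  by rewrite ME ?ltW// ltry.
pose nu : {finite_measure set (measurableTypeR R) -> \bar R} := mfrestr mab Fab.
have nu_mu : nu `<< mu.
  apply/null_content_dominatesP => A mA A0.
  rewrite /nu/= /mfrestr /mrestr.
  (* The null set may contain [b], while an open interval is required; the clamped function is
     absolutely continuous beyond [b] as well. *)
  apply: (@abs_cont_lebesgue_stieltjes0 F a (b + 1)).
  - by rewrite (lt_trans ab)// ltrDl.
  - exact: abs_cont_clamp (ltW ab) acN.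
  - exact: measurableI.
  - move=> x [_] /=; rewrite !in_itv/= => /andP[-> xb].
    by rewrite (le_lt_trans xb)// ltrDl.
  - by apply: (subset_measure0 _ _ _ A0) => //; exact: measurableI.
have [g [g0 gfin gint gE]] := radon_nikodym_sigma_finite nu_mu.
exists (fine \o g).
  apply: eq_integrable gint => //.
  by move=> x _ /=; rewrite fineK.
move=> x /andP[ax xb].
have := gE `]a, x]%classic (measurable_itv _).
rewrite /nu/= /mfrestr /mrestr setIidl; last by apply: subset_itvl; rewrite bnd_simp.
rewrite ME// /Nc => H.
have -> : N x - N a = F x - F a.
  by rewrite /F/= /Nc/= !clamp_id// ?lexx ?(ltW ab)// ax xb.
rewrite /Rintegral -[LHS]/(fine ((F x - F a)%:E)) H; congr fine.
rewrite -integral_itv_obnd_cbnd; last first.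
  have /integrableP[mg _] := gint.
  apply: (@measurable_funS _ _ _ _ setT) => //.
  by apply: eq_measurable_fun mg => y _ /=; rewrite fineK.
by apply: eq_integral => y _; rewrite /= fineK.
Qed.

(** Jordan decomposition G = V - (V - G), with V the variation of [G] from [a]: both terms are
    nondecreasing and absolutely continuous. *)
Lemma abs_cont_primitive a b G : a < b -> abs_cont a b G ->
  exists2 g : R -> R, mu.-integrable setT (EFin \o g) &
    forall x, a <= x <= b -> G x - G a = \int[mu]_(t in `[a, x]) g t.
Proof.
move=> ab acG; pose V x := fine (TV a x G).
have acV : abs_cont a b V := abs_cont_variation acG.
have fin := abs_cont_total_variation_lty acG.
have VG x y : a <= x -> x <= y -> y <= b -> `|G y - G x| <= V y - V x.
  move=> ax xy yb; rewrite /V.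
  have := fin y; rewrite (le_trans ax xy) yb => /(_ isT).
  rewrite (total_variationD G ax xy) => fin2.
  have T1 : (0 <= TV a x G)%E by exact: total_variation_ge0.
  have T2 : (0 <= TV x y G)%E by exact: total_variation_ge0.
  have F1 : TV a x G \is a fin_num by rewrite ge0_fin_numE// (le_lt_trans _ fin2)// leeDl.
  have F2 : TV x y G \is a fin_num by rewrite ge0_fin_numE// (le_lt_trans _ fin2)// leeDr.
  rewrite fineD// addrAC subrr add0r -lee_fin fineK//.
  exact: total_variation_ge.
have ndV : {in `[a, b] &, nondecreasing_fun V}.
  move=> x y; rewrite !in_itv/= => /andP[ax _] /andP[_ yb] xy.
  by rewrite -subr_ge0; apply: le_trans (VG _ _ ax xy yb).
have ndW : {in `[a, b] &, nondecreasing_fun (fun x => V x - G x)}.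
  move=> x y; rewrite !in_itv/= => /andP[ax _] /andP[_ yb] xy.
  have := le_trans (ler_norm _) (VG _ _ ax xy yb); lra.
have [g1 ig1 E1] := nondecreasing_abs_cont_primitive ab ndV acV.
have [g2 ig2 E2] := nondecreasing_abs_cont_primitive ab ndW (abs_contD acV (abs_contN acG)).
exists (fun x => g1 x - g2 x).
  have := integrableB measurableT ig1 ig2.
  by apply: eq_integrable => // x _ /=; rewrite EFinB.
move=> x xab; rewrite RintegralB//; last 2 first.
- by apply: integrableS ig1.
- by apply: integrableS ig2.
by rewrite -E1// -E2//; lra.
Qed.

Lemma abs_cont_derive_ae a b G : a < b -> abs_cont a b G ->
  exists g : R -> R, [/\ mu.-integrable setT (EFin \o g),
    forall x, a <= x <= b -> G x - G a = \int[mu]_(t in `[a, x]) g t &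
    {ae mu, forall x, a < x < b -> derivable G x 1 /\ derive1 G x = g x}].
Proof.
move=> ab acG; have [g ig gE] := abs_cont_primitive ab acG.
exists g; split => //.
have int_g y : mu.-integrable [set` Interval (BLeft a) (BRight y)] (EFin \o g).
  by apply: integrableS ig.
have loc_g : locally_integrable [set: R] g.
  by apply: open_integrable_locally => //; exact: openT.
have := FTC1 int_g loc_g; apply: filterS; first exact: (ae_filter_ringOfSetsType mu).
move=> x H /andP[ax xb].
have ax' : (BLeft a < BRight x)%E by first [exact: ltW | exact: ax | by rewrite /Order.lt/= ltW].
have [dF F'] := H ax'.
pose F y := \int[mu]_(t in `[a, y]) g t.
have nF : {near x, cst (G a) + F =1 G}.
  have : \forall y \near x, y \in `]a, b[ by apply: near_in_itvoo; rewrite in_itv/= ax.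
  apply: filterS => y; rewrite in_itv/= => /andP[ay yb].
  have := gE y; rewrite (ltW ay) (ltW yb) => /(_ isT) Gy.
  by rewrite fctE /= /F -Gy addrC subrK.
split.
  by apply: (@near_eq_derivable _ R^o R^o _ _ _ _ nF); apply: derivableD; [exact: derivable_cst|exact: dF].
rewrite derive1E -(@near_eq_derive _ R^o R^o _ _ _ 1 nF) deriveD; [|exact: derivable_cst|exact: dF].
by rewrite derive_cst add0r -derive1E.
Qed.

(** Both [U] and [G] are differentiable almost everywhere, so G' = h almost everywhere and the
    density of [G] can be replaced by [h]. *)
Lemma abs_cont_FTC2 a b (U G h : R -> R) : a < b ->
  abs_cont a b U -> abs_cont a b G -> mu.-integrable `[a, b] (EFin \o h) ->
  (forall x, a < x < b -> derivable U x 1 -> derive1 G x = h x) ->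
  G b - G a = \int[mu]_(t in `[a, b]) h t.
Proof.
move=> ab acU acG ih hE.
have [g [ig gE aeG]] := abs_cont_derive_ae ab acG.
have [g' [_ _ aeU]] := abs_cont_derive_ae ab acU.
rewrite gE ?lexx ?(ltW ab)// /Rintegral; congr fine.
have ig' : mu.-integrable `]a, b[ (EFin \o g) by apply: integrableS ig.
have ih' : mu.-integrable `]a, b[ (EFin \o h).
  by apply: integrableS ih => //; exact: subset_itv_oo_cc.
rewrite [LHS]integral_itv_bndoo; last exact: measurable_int ig'.
rewrite [RHS]integral_itv_bndoo; last exact: measurable_int ih'.
apply: ae_eq_integral => //; [exact: measurable_int ig'|exact: measurable_int ih'|].
move: aeG aeU; apply: filterS2; first exact: (ae_filter_ringOfSetsType mu).
move=> x Gx Ux /=; rewrite in_itv/= => xab.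
have [_ <-] := Gx xab; have [dU _] := Ux xab.
by rewrite hE.
Qed.

(* [U] only serves to locate the exceptional null set: the identity for the
   derivative of [G] is required where [U] is differentiable. *)
Lemma abs_cont_cvg_endpoints a b (U G h : R -> R) : a < b ->
  (forall x y, a < x -> x < y -> y < b -> abs_cont x y U) ->
  (forall x y, a < x -> x < y -> y < b -> abs_cont x y G) ->
  mu.-integrable `]a, b[ (EFin \o h) ->
  (forall x, a < x < b -> derivable U x 1 -> derive1 G x = h x) ->
  cvg (G x @[x --> b^'-]) /\ cvg (G x @[x --> a^'+]).
Proof.
(* Extension by 0 makes the integrand integrable on the closed interval, as the continuity of the
   parameterized integral up to the endpoints demands. *)
move=> ab acU acG ih hE; pose h' := h \_ `]a, b[.
have ih' : mu.-integrable `[a, b] (EFin \o h').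
  rewrite -restrict_EFin; apply/integrable_restrict => //.
  by rewrite setIidr//; exact: subset_itv_oo_cc.
have h'E x : a < x < b -> h' x = h x by move=> xab; rewrite /h' patchE mem_set.
pose H x := parameterized_integral mu a x h'.
have key x y : a < x -> x < y -> y < b -> G y - G x = H y - H x.
  move=> ax xy yb.
  have ihy : mu.-integrable `[a, y] (EFin \o h').
    by apply: integrableS ih' => //; apply: subset_itvl; rewrite bnd_simp ltW.
  have ihxy : mu.-integrable `[x, y] (EFin \o h').
    by apply: integrableS ihy => //; apply: subset_itvr; rewrite bnd_simp ltW.
  rewrite /H /parameterized_integral Rintegral_itvB//; last 2 first.
  - by rewrite bnd_simp ltW.
  - by rewrite bnd_simp ltW.
  rewrite Rintegral_itv_obnd_cbnd; last first.
    by apply: integrableS ihxy => //; apply: subset_itvr; rewrite bnd_simp.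
  apply: (abs_cont_FTC2 xy (acU _ _ ax xy yb) (acG _ _ ax xy yb) ihxy).
  move=> z /andP[xz zy] Uz; rewrite h'E; first apply: hE => //.
    by rewrite (lt_trans ax xz) (lt_trans zy yb).
  by rewrite (lt_trans ax xz) (lt_trans zy yb).
(* An interior base point, since [G] is controlled only on compact subintervals. *)
pose c := (a + b) / 2.
have ac : a < c by rewrite /c; lra.
have cb : c < b by rewrite /c; lra.
have GE x : a < x < b -> G x = G c - H c + H x.
  move=> /andP[ax xb]; have [xc|cx|->] := ltgtP x c.
  - by have := key _ _ ax xc cb; lra.
  - by have := key _ _ ac cx xb; lra.
  - by rewrite subrK.
split.
  apply/cvg_ex; exists (G c - H c + H b).
  have : G c - H c + H x @[x --> b^'-] --> G c - H c + H b.
    apply: cvgD; first exact: cvg_cst.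
    exact: parameterized_integral_cvg_at_left.
  apply: cvg_trans; apply: near_eq_cvg; near=> x.
  by rewrite (GE x)//; apply/andP; split; near: x; [exact: nbhs_left_gt|exact: nbhs_left_lt].
apply/cvg_ex; exists (G c - H c + 0).
have : G c - H c + H x @[x --> a^'+] --> G c - H c + 0.
  apply: cvgD; first exact: cvg_cst.
  exact: (cvg_at_right_filter (parameterized_integral_cvg_left ab ih')).
apply: cvg_trans; apply: near_eq_cvg; near=> x.
by rewrite (GE x)//; apply/andP; split; near: x; [exact: nbhs_right_gt|exact: nbhs_right_lt].
Unshelve. all: by end_near. Qed.

End absolute_continuity.

(** * Derivatives at a point and increments of functions *)

Section pointwise_derivatives.
Context {R : realType}.
Implicit Types (a b x y c : R) (F G : R -> R).

Lemma near_itv a b x : a < x < b -> \forall y \near x, a < y < b.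
Proof.
move=> xab; have : \forall y \near x, y \in `]a, b[ by apply: near_in_itvoo; rewrite in_itv.
by apply: filterS => y; rewrite in_itv.
Qed.

Lemma derivable_eq_itv a b F G x : (forall y, a < y < b -> F y = G y) ->
  a < x < b -> derivable F x 1 -> derivable G x 1.
Proof.
move=> FG xab; apply: (@near_eq_derivable R R^o R^o).
by have := near_itv xab; apply: filterS => y /FG.
Qed.

Lemma derive1_eq_itv a b F G x : (forall y, a < y < b -> F y = G y) ->
  a < x < b -> derive1 F x = derive1 G x.
Proof.
move=> FG xab; rewrite !derive1E; apply: (@near_eq_derive R R^o R^o).
by have := near_itv xab; apply: filterS => y /FG.
Qed.

Lemma derivable_add F G x : derivable F x 1 -> derivable G x 1 ->
  derivable (fun y => F y + G y) x 1.
Proof. exact: derivableD. Qed.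

Lemma derive1_add F G x : derivable F x 1 -> derivable G x 1 ->
  derive1 (fun y => F y + G y) x = derive1 F x + derive1 G x.
Proof. by move=> dF dG; rewrite !derive1E; exact: deriveD. Qed.

Lemma derivable_mul F G x : derivable F x 1 -> derivable G x 1 ->
  derivable (fun y => F y * G y) x 1.
Proof. exact: derivableM. Qed.

Lemma derive1_mul F G x : derivable F x 1 -> derivable G x 1 ->
  derive1 (fun y => F y * G y) x = derive1 F x * G x + F x * derive1 G x.
Proof.
move=> dF dG; rewrite !derive1E (deriveM dF dG).
by rewrite addrC; congr (_ + _); rewrite mulrC.
Qed.

Lemma derivable_const c x : derivable (fun=> c : R) x 1.
Proof. exact: derivable_cst. Qed.

Lemma derive1_const c : derive1 (fun=> c : R) = (fun=> 0).
Proof. by apply/funext => x; rewrite derive1E derive_cst. Qed.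

Lemma derivable_opp F x : derivable F x 1 -> derivable (fun y => - F y) x 1.
Proof. exact: derivableN. Qed.

Lemma derive1_opp F x : derivable F x 1 ->
  derive1 (fun y => - F y) x = - derive1 F x.
Proof. by move=> dF; rewrite !derive1E; exact: deriveN. Qed.

Lemma derivable_continuous F x : derivable F x 1 -> {for x, continuous F}.
Proof. by move=> /derivable1_diffP/differentiable_continuous. Qed.

Lemma is_derive1_derive1 F x : derivable F x 1 -> is_derive x 1 F (derive1 F x).
Proof. by move=> dF; rewrite derive1E; exact: DeriveDef. Qed.

Lemma is_derive_powR_sub (g x : R) : x < 1 ->
  is_derive x 1 (fun y : R => (1 - y) `^ g) (- g * (1 - x) `^ (g - 1)).
Proof.
move=> x1; have p : 0 < 1 - x by rewrite subr_gt0.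
have d1 : is_derive x 1 (fun y : R => 1 - y) (- 1).
  have := @is_deriveB R R^o R^o (cst 1) id x 1 0 1 _ _.
  by rewrite sub0r; apply.
have := @is_derive1_comp R (fun a : R => a `^ g) (fun y => 1 - y) x _ _ (is_derive1_powR g p) d1.
by rewrite mulrN1 mulNr.
Qed.

Lemma is_derive_powR_add (g x : R) : -1 < x ->
  is_derive x 1 (fun y : R => (1 + y) `^ g) (g * (1 + x) `^ (g - 1)).
Proof.
move=> x1; have p : 0 < 1 + x by lra.
have d1 : is_derive x 1 (fun y : R => 1 + y) 1.
  have := @is_deriveD R R^o R^o (cst 1) id x 1 0 1 _ _.
  by rewrite add0r; apply.
have := @is_derive1_comp R (fun a : R => a `^ g) (fun y => 1 + y) x _ _ (is_derive1_powR g p) d1.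
by rewrite mulr1.
Qed.

Lemma derivable_powR_sub (g x : R) : x < 1 -> derivable (fun y : R => (1 - y) `^ g) x 1.
Proof. by move=> /(is_derive_powR_sub g)[]. Qed.

Lemma derive1_powR_sub (g x : R) : x < 1 ->
  derive1 (fun y : R => (1 - y) `^ g) x = - g * (1 - x) `^ (g - 1).
Proof. by move=> /(is_derive_powR_sub g)[_ <-]; rewrite derive1E. Qed.

Lemma derivable_powR_add (g x : R) : -1 < x -> derivable (fun y : R => (1 + y) `^ g) x 1.
Proof. by move=> /(is_derive_powR_add g)[]. Qed.

Lemma derive1_powR_add (g x : R) : -1 < x ->
  derive1 (fun y : R => (1 + y) `^ g) x = g * (1 + x) `^ (g - 1).
Proof. by move=> /(is_derive_powR_add g)[_ <-]; rewrite derive1E. Qed.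

(** Both H + F and H - F are nondecreasing. A majorant [H] in place of a constant allows singular
    bounds on the derivative to be integrated. *)
Lemma le_derive1_increment a b F H x y :
  (forall z, a < z < b -> derivable F z 1) ->
  (forall z, a < z < b -> derivable H z 1) ->
  (forall z, a < z < b -> `|derive1 F z| <= derive1 H z) ->
  a < x -> x <= y -> y < b -> `|F y - F x| <= H y - H x.
Proof.
move=> dF dH le ax xy yb.
have sub z : x <= z <= y -> a < z < b.
  by move=> /andP[xz zy]; rewrite (lt_le_trans ax xz) (le_lt_trans zy yb).
have nd (K : R -> R) : (forall z, a < z < b -> derivable K z 1) ->
    (forall z, a < z < b -> 0 <= derive1 K z) -> K x <= K y.
  move=> dK K0; apply: (@ger0_derive1_ndecr R K x y) => //.
  - move=> z; rewrite in_itv/= => /andP[xz zy]; apply: dK; apply: sub.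
    by rewrite !ltW.
  - move=> z; rewrite in_itv/= => /andP[xz zy]; apply: K0; apply: sub.
    by rewrite !ltW.
  - apply: derivable_within_continuous => z; rewrite in_itv/= => zxy.
    exact/dK/sub.
have h1 : H x + F x <= H y + F y.
  apply: (nd (fun z => H z + F z)) => z zab; first exact: derivable_add (dH _ zab) (dF _ zab).
  rewrite (derive1_add (dH _ zab) (dF _ zab)); have := le _ zab; rewrite ler_norml => /andP[h h']; lra.
have h2 : H x - F x <= H y - F y.
  apply: (nd (fun z => H z + - F z)) => z zab.
    by apply: derivable_add (dH _ zab) _; apply: derivable_opp; exact: dF.
  rewrite (derive1_add (dH _ zab)); last by apply: derivable_opp; exact: dF.
  rewrite (derive1_opp (dF _ zab)); have := le _ zab; rewrite ler_norml => /andP[h h']; lra.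
by rewrite ler_norml; apply/andP; split; lra.
Qed.

Lemma bounded_derive1_increment a b F (M : R) x y :
  (forall z, a < z < b -> derivable F z 1) ->
  (forall z, a < z < b -> `|derive1 F z| <= M) ->
  a < x < b -> a < y < b -> `|F y - F x| <= M * `|y - x|.
Proof.
move=> dF le; wlog xy : x y / x <= y.
  move=> H xab yab; have [/H|/ltW/H] := leP x y; first exact.
  by rewrite distrC (distrC x); exact.
move=> /andP[ax _] /andP[_ yb].
have dM (z : R) : is_derive z 1 (fun z : R => M * z) M.
  have := @is_deriveZ R R^o R^o id M z 1 1 _.
  by rewrite [M *: 1]mulr1; apply.
have dM1 (z : R) : derive1 (fun z : R => M * z) z = M by rewrite derive1E; case: (dM z).
rewrite (ger0_norm (_ : 0 <= y - x)) ?subr_ge0// mulrBr.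
have dMd (z : R) : derivable (fun z : R => M * z) z 1 by case: (dM z).
apply: (le_derive1_increment dF (fun z _ => dMd z) _ ax xy yb) => z zab.
by rewrite dM1; exact: le.
Qed.

(** The function F(x) + M x is nondecreasing and bounded above near [b], hence convergent;
    subtracting M x gives the limit of [F]. *)
Lemma cvg_at_left_bounded_derive1 a b F (M : R) : a < b ->
  (forall z, a < z < b -> derivable F z 1) ->
  (forall z, a < z < b -> `|derive1 F z| <= M) ->
  cvg (F x @[x --> b^'-]).
Proof.
move=> ab dF le.
have incr x y : a < x -> x <= y -> y < b -> `|F y - F x| <= M * (y - x).
  move=> ax xy yb; rewrite -[y - x]ger0_norm ?subr_ge0//.
  apply: (bounded_derive1_increment dF le); first by rewrite ax (le_lt_trans xy).
  by rewrite (lt_le_trans ax) .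
have M0 : 0 <= M.
  have c : a < (a + b) / 2 < b by apply/andP; split; lra.
  exact: le_trans (le _ c).
pose G x := F x + M * x.
have cvG : cvg (G x @[x --> b^'-]).
  apply: nondecreasing_at_left_is_cvgr.
    near=> c; have ac : a < c by near: c; exact: nbhs_left_gt.
    move=> x y; rewrite !in_itv/= => /andP[cx _] /andP[_ yb] xy.
    have := incr x y (lt_trans ac cx) xy yb.
    by rewrite ler_norml /G => /andP[+ _]; lra.
  near=> c; have ac : a < c by near: c; exact: nbhs_left_gt.
  have cb : c < b by near: c; exact: nbhs_left_lt.
  exists (F c + M * (b - c) + M * b) => _ [x /= + <-].
  rewrite in_itv/= => /andP[cx xb].
  have := incr c x ac (ltW cx) xb; rewrite ler_norml => /andP[_ h].
  have h1 : M * (x - c) <= M * (b - c) by rewrite ler_wpM2l// lerB// ltW.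
  have h2 : M * x <= M * b by rewrite ler_wpM2l// ltW.
  by rewrite /G; lra.
have cvM : cvg ((fun x => M * x) x @[x --> b^'-]).
  apply/cvg_ex; exists (M * b); apply: cvgM; first exact: cvg_cst.
  by apply: cvg_at_left_filter; exact: cvg_id.
have -> : F = G - (fun x => M * x) by apply/funext => x; rewrite !fctE /G /= addrK.
exact: is_cvgB.
Unshelve. all: by end_near. Qed.

Lemma at_left_witness a b (P : R -> Prop) : a < b -> (\forall x \near b^'-, P x) ->
  exists2 c, a < c < b & forall x, c < x < b -> P x.
Proof.
move=> ab [d /= d0 Hd].
exists (Num.max ((a + b) / 2) (b - d / 2)).
  by apply/andP; split; [rewrite lt_max; apply/orP; left; lra|rewrite gt_max; apply/andP; split; lra].
move=> x /andP[]; rewrite gt_max => /andP[h1 h2] xb; apply: Hd => //=.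
by rewrite gtr0_norm; lra.
Qed.

Lemma at_right_witness a b (P : R -> Prop) : a < b -> (\forall x \near a^'+, P x) ->
  exists2 c, a < c < b & forall x, a < x < c -> P x.
Proof.
move=> ab [d /= d0 Hd].
exists (Num.min ((a + b) / 2) (a + d / 2)).
  by apply/andP; split; [rewrite lt_min; apply/andP; split; lra|rewrite gt_min; apply/orP; left; lra].
move=> x /andP[ax]; rewrite lt_min => /andP[h1 h2]; apply: Hd => //=.
by rewrite ltr0_norm; lra.
Qed.

Lemma bounded_near_cvg (Fl : set_system R) (FF : ProperFilter Fl) F :
  cvg (F x @[x --> Fl]) -> exists M, \forall x \near Fl, `|F x| <= M.
Proof.
move=> /cvg_ex[l Fl_l]; exists (`|l| + 1).
have /cvgrPdist_le/(_ _ ltr01) := Fl_l; apply: filterS => x h.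
by rewrite -[F x](subKr l); apply: le_trans (ler_normB _ _) _; rewrite lerD2l.
Qed.

End pointwise_derivatives.

(** * Products and Lipschitz functions among absolutely continuous functions *)

Section abs_cont_algebra.
Context {R : realType}.
Implicit Types (a b x y c M : R) (F G u : R -> R).

Lemma abs_cont_eq a b F G : (forall x, a <= x <= b -> F x = G x) ->
  abs_cont a b F -> abs_cont a b G.
Proof.
move=> FG acF e /acF[d d0 Hd]; exists d => // s fs ss.
rewrite (le_lt_trans _ (Hd _ fs ss))// big_seq [leRHS]big_seq.
apply: ler_sum => p ps; have /andP[/allP/(_ _ ps)/andP[/andP[h1 h2] h3] _] := fs.
by rewrite !FG// ?h1 ?h3 (le_trans h1 h2, le_trans h2 h3).
Qed.

Lemma abs_cont_bounded a b G : a <= b -> abs_cont a b G ->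
  exists M, forall x, a <= x <= b -> `|G x| <= M.
Proof.
move=> ab acG; have fin := abs_cont_total_variation_lty acG.
have Tb : total_variation a b G \is a fin_num.
  by rewrite ge0_fin_numE ?total_variation_ge0// fin// ab lexx.
exists (`|G a| + fine (total_variation a b G)) => x /andP[ax xb].
rewrite -lerBlDl; apply: le_trans (lerB_dist _ _) _.
rewrite -lee_fin fineK//; apply: le_trans (total_variation_ge _ ax) _.
rewrite (total_variationD _ ax xb) leeDl//; exact: total_variation_ge0.
Qed.

Lemma abs_contM a b F G : a <= b -> abs_cont a b F -> abs_cont a b G ->
  abs_cont a b (fun x => F x * G x).
Proof.
move=> ab acF acG.
have [M HM] := abs_cont_bounded ab acF; have [N HN] := abs_cont_bounded ab acG.
have aab : a <= a <= b by rewrite lexx.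
have M0 : 0 <= M := le_trans (normr_ge0 _) (HM _ aab).
have N0 : 0 <= N := le_trans (normr_ge0 _) (HN _ aab).
move=> e e0.
have K0 : 0 < M + N + 1 by lra.
have eK : 0 < e / (M + N + 1) by rewrite divr_gt0.
have [d d0 Hd] := acF _ eK; have [d' d'0 Hd'] := acG _ eK.
exists (Num.min d d'); first by rewrite lt_min d0.
move=> s fs; rewrite lt_min => /andP[/(Hd _ fs) h /(Hd' _ fs) h'].
apply: (@le_lt_trans _ _ (N * \sum_(p <- s) `|F p.2 - F p.1| +
    M * \sum_(p <- s) `|G p.2 - G p.1|)).
  rewrite !mulr_sumr -big_split/= big_seq [leRHS]big_seq; apply: ler_sum => p ps.
  have /andP[/allP/(_ _ ps)/andP[/andP[h1 h2] h3] _] := fs.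
  have -> : F p.2 * G p.2 - F p.1 * G p.1 =
    (F p.2 - F p.1) * G p.2 + F p.1 * (G p.2 - G p.1) by ring.
  apply: le_trans (ler_normD _ _) _; rewrite !normrM; apply: lerD.
    by rewrite mulrC ler_wpM2r// HN// h3 (le_trans h1 h2).
  by rewrite ler_wpM2r// HM// h1 (le_trans h2 h3).
apply: (@le_lt_trans _ _ ((M + N) * (e / (M + N + 1)))).
  rewrite mulrDl addrC; apply: lerD; apply: ler_wpM2l => //; exact: ltW.
rewrite mulrA ltr_pdivrMr// mulrC ltr_pM2l//; lra.
Qed.

Lemma abs_cont_lipschitz a b M F :
  (forall x y, a <= x -> x <= y -> y <= b -> `|F y - F x| <= M * (y - x)) ->
  abs_cont a b F.
Proof.
move=> lip e e0; have K0 : 0 < `|M| + 1 by rewrite ltr_pwDr.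
exists (e / (`|M| + 1)); first by rewrite divr_gt0.
move=> s fs; rewrite ltr_pdivlMr// => ss; apply: le_lt_trans ss.
rewrite mulr_suml big_seq [leRHS]big_seq; apply: ler_sum => p ps.
have /andP[/allP/(_ _ ps)/andP[/andP[h1 h2] h3] _] := fs.
apply: le_trans (lip _ _ h1 h2 h3) _; rewrite mulrC ler_wpM2l ?subr_ge0//.
by rewrite (le_trans (ler_norm _))// lerDl.
Qed.

End abs_cont_algebra.

(** * Linear differential expressions with smooth coefficients *)

Section differential_expressions.
Context {R : realType}.
Implicit Types (a b x y c M g : R) (F G u : R -> R) (k N K : nat).

(** Only points of (-1,1) count: the coefficients are real powers of 1-x and 1+x, which may be
    singular at the endpoints. *)
Fixpoint ndiff N F : Prop := if N is N'.+1
  then (forall x, -1 < x < 1 -> derivable F x 1) /\ ndiff N' (derive1 F)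
  else True.

Definition csmooth F := forall N, ndiff N F.

Lemma ndiff_eq N F G : (forall x, -1 < x < 1 -> F x = G x) -> ndiff N F -> ndiff N G.
Proof.
elim: N F G => //= N IH F G FG [dF nF]; split.
  by move=> x xI; apply: (derivable_eq_itv FG xI); exact: dF.
by apply: IH nF => x xI; exact: derive1_eq_itv FG xI.
Qed.

Lemma ndiffS N F : ndiff N.+1 F -> ndiff N F.
Proof. by elim: N F => //= N IH F [dF [dF' nF]]; split => //; exact: IH. Qed.

Lemma ndiffD N F G : ndiff N F -> ndiff N G -> ndiff N (fun x => F x + G x).
Proof.
elim: N F G => //= N IH F G [dF nF] [dG nG]; split.
  by move=> x xI; apply: derivable_add; [exact: dF|exact: dG].
apply: ndiff_eq (IH _ _ nF nG) => x xI.
by rewrite derive1_add//; [exact: dF|exact: dG].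
Qed.

Lemma ndiffM N F G : ndiff N F -> ndiff N G -> ndiff N (fun x => F x * G x).
Proof.
elim: N F G => //= N IH F G [dF nF] [dG nG]; split.
  by move=> x xI; apply: derivable_mul; [exact: dF|exact: dG].
have nF' : ndiff N F by apply: ndiffS; split.
have nG' : ndiff N G by apply: ndiffS; split.
apply: ndiff_eq (ndiffD (IH _ _ nF nG') (IH _ _ nF' nG)) => x xI.
by rewrite derive1_mul//; [exact: dF|exact: dG].
Qed.

Lemma ndiff_const N c : ndiff N (fun=> c).
Proof.
elim: N c => //= N IH c; split; first by move=> x _; exact: derivable_const.
by rewrite derive1_const.
Qed.

Lemma csmoothM F G : csmooth F -> csmooth G -> csmooth (fun x => F x * G x).
Proof. by move=> sF sG N; exact: ndiffM. Qed.

Lemma csmooth_const c : csmooth (fun=> c).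
Proof. by move=> N; exact: ndiff_const. Qed.

Lemma csmooth_derive1 F : csmooth F -> csmooth (derive1 F).
Proof. by move=> sF N; have [] := sF N.+1. Qed.

Lemma csmooth_derivable F x : csmooth F -> -1 < x < 1 -> derivable F x 1.
Proof. by move=> sF; have [+ _] := sF 1%N; apply. Qed.

Lemma csmooth_powR_sub g : csmooth (fun x : R => (1 - x) `^ g).
Proof.
move=> N; elim: N g => //= N IH g; split.
  by move=> x /andP[_ x1]; exact: derivable_powR_sub.
apply: ndiff_eq (ndiffM (ndiff_const N (- g)) (IH (g - 1))) => x /andP[_ x1].
by rewrite derive1_powR_sub.
Qed.

Lemma csmooth_powR_add g : csmooth (fun x : R => (1 + x) `^ g).
Proof.
move=> N; elim: N g => //= N IH g; split.
  by move=> x /andP[x1 _]; exact: derivable_powR_add.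
apply: ndiff_eq (ndiffM (ndiff_const N g) (IH (g - 1))) => x /andP[x1 _].
by rewrite derive1_powR_add.
Qed.

Lemma csmooth_abs_cont F x y : csmooth F -> -1 < x -> x < y -> y < 1 -> abs_cont x y F.
Proof.
move=> sF x1 xy y1.
have c' : {within `[x, y], continuous (fun z => derive1 F z)}.
  apply: derivable_within_continuous => z; rewrite in_itv/= => /andP[xz zy].
  by apply: csmooth_derivable (csmooth_derive1 sF) _; rewrite (lt_le_trans x1 xz) (le_lt_trans zy y1).
have [zM _ HM] := EVT_max (ltW xy) c'; have [zm _ Hm] := EVT_min (ltW xy) c'.
(* On the compact segment the derivative lies between its values at [zm] and [zM], so [M] is a
   Lipschitz constant. *)
pose M := `|derive1 F zM| + `|derive1 F zm|.
apply: (@abs_cont_lipschitz _ _ _ M) => a b xa ab b1.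
have /= := @MVT_segment R F (derive1 F) a b ab.
case.
- move=> z; rewrite in_itv/= => /andP[az zb]; rewrite derive1E.
  apply: DeriveDef => //; apply: csmooth_derivable => //.
  by rewrite (lt_trans (lt_le_trans x1 xa) az) (lt_trans zb (le_lt_trans b1 y1)).
- apply: derivable_within_continuous => z; rewrite in_itv/= => /andP[az zb].
  apply: csmooth_derivable => //.
  by rewrite (lt_le_trans (lt_le_trans x1 xa) az) (le_lt_trans zb (le_lt_trans b1 y1)).
move=> z; rewrite in_itv/= => /andP[az zb] ->; rewrite normrM (@ger0_norm _ (b - a)) ?subr_ge0//.
apply: ler_wpM2r; rewrite ?subr_ge0//.
have zxy : z \in `[x, y] by rewrite in_itv/= (le_trans xa az) (le_trans zb b1).
have h1 := HM _ zxy; have h2 := Hm _ zxy.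
rewrite ler_norml /M; have := ler_norm (derive1 F zM); have := lerNnormlW (lexx (`|derive1 F zm|)).
have := normr_ge0 (derive1 F zM); have := normr_ge0 (derive1 F zm).
move=> *; apply/andP; split; lra.
Qed.

(* Linear differential expressions in [u] of order at most [N], with smooth
   coefficients on (-1,1). *)
Inductive diffexp u : nat -> (R -> R) -> Prop :=
| diffexp_base i N : (i <= N)%N -> diffexp u N (derive1n i u)
| diffexpM N (c : R -> R) F : csmooth c -> diffexp u N F -> diffexp u N (fun x => c x * F x)
| diffexpD N F G : diffexp u N F -> diffexp u N G -> diffexp u N (fun x => F x + G x)
| diffexp_eq N F G : (forall x, -1 < x < 1 -> F x = G x) -> diffexp u N F -> diffexp u N G.

Lemma diffexp_le u N N' F : (N <= N')%N -> diffexp u N F -> diffexp u N' F.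
Proof.
move=> NN' dF; elim: dF N' NN' => {N F}.
- by move=> i N iN N' NN'; apply: diffexp_base; exact: leq_trans NN'.
- by move=> N c F sc _ IH N' NN'; apply: diffexpM => //; exact: IH.
- by move=> N F G _ IHF _ IHG N' NN'; apply: diffexpD; [exact: IHF|exact: IHG].
- by move=> N F G FG _ IH N' NN'; apply: diffexp_eq FG _; exact: IH.
Qed.

Lemma diffexpZ u N c F : diffexp u N F -> diffexp u N (fun x => c * F x).
Proof. by apply: diffexpM; exact: csmooth_const. Qed.

Lemma diffexpB u N F G : diffexp u N F -> diffexp u N G ->
  diffexp u N (fun x => F x - G x).
Proof.
move=> dF dG; apply: (@diffexp_eq _ _ (fun x => F x + (-1) * G x)).
  by move=> x _; rewrite mulN1r.
by apply: diffexpD => //; exact: diffexpZ.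
Qed.

(** Differentiability of the derivative of order [K] is asked at the single point [x]: this is what
    is known of f^(2n-1) at almost every point. *)
Lemma diffexp_derivable_at u K N F x : -1 < x < 1 -> (N <= K)%N ->
  (forall k y, (k < K)%N -> -1 < y < 1 -> derivable (derive1n k u) y 1) ->
  derivable (derive1n K u) x 1 ->
  diffexp u N F -> derivable F x 1.
Proof.
move=> xI NK du duK dF; elim: dF NK => {N F}.
- move=> i N iN NK; have := leq_trans iN NK; rewrite leq_eqVlt => /orP[/eqP->//|iK].
  exact: du.
- move=> N c F sc _ IH NK; apply: derivable_mul; last exact: IH.
  exact: csmooth_derivable.
- by move=> N F G _ IHF _ IHG NK; apply: derivable_add; [exact: IHF|exact: IHG].
- by move=> N F G FG _ IH NK; apply: derivable_eq_itv FG xI _; exact: IH.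
Qed.

Lemma diffexp_derivable u K N F x : (N < K)%N -> -1 < x < 1 ->
  (forall k y, (k < K)%N -> -1 < y < 1 -> derivable (derive1n k u) y 1) ->
  diffexp u N F -> derivable F x 1.
Proof.
move=> NK xI du; apply: (diffexp_derivable_at xI (leqnn N)); last exact: du.
by move=> k y kN; apply: du; exact: ltn_trans NK.
Qed.

Lemma diffexp_derive1 u K N F : (N < K)%N ->
  (forall k y, (k < K)%N -> -1 < y < 1 -> derivable (derive1n k u) y 1) ->
  diffexp u N F -> diffexp u N.+1 (derive1 F).
Proof.
move=> NK du dF; elim: dF NK => {N F}.
- by move=> i N iN NK; rewrite -derive1nS; exact: diffexp_base.
- move=> N c F sc dF IH NK.
  apply: (@diffexp_eq _ _ (fun x => derive1 c x * F x + c x * derive1 F x)).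
    move=> x xI; rewrite derive1_mul//; first exact: csmooth_derivable.
    exact: diffexp_derivable NK xI du dF.
  apply: diffexpD; apply: diffexpM => //; last exact: IH.
    exact: csmooth_derive1.
  exact: diffexp_le dF.
- move=> N F G dF IHF dG IHG NK.
  apply: (@diffexp_eq _ _ (fun x => derive1 F x + derive1 G x)).
    move=> x xI; rewrite derive1_add//; exact: diffexp_derivable NK xI du _.
  by apply: diffexpD; [exact: IHF|exact: IHG].
- move=> N F G FG _ IH NK; apply: diffexp_eq (IH NK) => x xI.
  exact: derive1_eq_itv FG xI.
Qed.

Lemma diffexp_derive1n u K N F k : (N + k <= K)%N ->
  (forall k y, (k < K)%N -> -1 < y < 1 -> derivable (derive1n k u) y 1) ->
  diffexp u N F -> diffexp u (N + k) (derive1n k F).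
Proof.
elim: k => [|k IH] NK du dF; first by rewrite addn0.
rewrite addnS derive1nS; apply: (@diffexp_derive1 u K) => //.
  by rewrite -addnS.
by apply: IH => //; rewrite (leq_trans _ NK)// leq_add2l.
Qed.

Lemma diffexp_abs_cont u K N F : (N <= K)%N ->
  (forall k x y, (k <= K)%N -> -1 < x -> x < y -> y < 1 -> abs_cont x y (derive1n k u)) ->
  diffexp u N F -> forall x y, -1 < x -> x < y -> y < 1 -> abs_cont x y F.
Proof.
move=> NK acu dF x y x1 xy y1; elim: dF NK => {N F}.
- by move=> i N iN NK; apply: acu => //; exact: leq_trans NK.
- move=> N c F sc _ IH NK; apply: abs_contM; first exact: ltW; last exact: IH.
  exact: csmooth_abs_cont.
- by move=> N F G _ IHF _ IHG NK; apply: abs_contD; [exact: IHF|exact: IHG].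
- move=> N F G FG _ IH NK; apply: abs_cont_eq (IH NK) => z /andP[xz zy].
  by apply: FG; rewrite (lt_le_trans x1 xz) (le_lt_trans zy y1).
Qed.

End differential_expressions.

(** * Growth of derivatives near the endpoint 1 *)

Section symbols.
Context {R : realType}.
Implicit Types (a b x y c M g h : R) (F G u : R -> R) (k N K : nat).

(* Symbol class at the endpoint 1: the i-th derivative is O((1-x)^(g-i)) on
   (0,1) for all i <= N. *)
Fixpoint symb N g F : Prop :=
  (exists M, forall x, 0 < x < 1 -> `|F x| <= M * (1 - x) `^ g) /\
  (if N is N'.+1 then (forall x, 0 < x < 1 -> derivable F x 1) /\
     symb N' (g - 1) (derive1 F) else True).

Lemma symb_bound N g F : symb N g F ->
  exists M, forall x, 0 < x < 1 -> `|F x| <= M * (1 - x) `^ g.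
Proof. by case: N => [|N] []. Qed.

Lemma symb_derivable N g F x : symb N.+1 g F -> 0 < x < 1 -> derivable F x 1.
Proof. by move=> [_ [+ _]]; apply. Qed.

Lemma symb_derive1 N g F : symb N.+1 g F -> symb N (g - 1) (derive1 F).
Proof. by move=> [_ []]. Qed.

Lemma symb_derive1n N g F k : symb (N + k) g F -> symb N (g - k%:R) (derive1n k F).
Proof.
elim: k N => [|k IH] N; first by rewrite addn0 subr0.
rewrite addnS -addSn => /IH /symb_derive1.
by rewrite derive1nS -natr1 opprD addrA.
Qed.

Lemma powR_sub_le g h x : g <= h -> 0 < x < 1 -> (1 - x) `^ h <= (1 - x) `^ g.
Proof.
move=> gh /andP[x0 x1]; apply: ger_powR => //.
by apply/andP; split; lra.
Qed.

Lemma symb_weaken N g h F : g <= h -> symb N h F -> symb N g F.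
Proof.
elim: N g h F => [|N IH] g h F gh [[M HM] r]; split.
- exists `|M| => x x01; apply: le_trans (HM _ x01) _.
  apply: (@le_trans _ _ (`|M| * (1 - x) `^ h)); first by rewrite ler_wpM2r ?powR_ge0// ler_norm.
  by rewrite ler_wpM2l// powR_sub_le.
- by [].
- exists `|M| => x x01; apply: le_trans (HM _ x01) _.
  apply: (@le_trans _ _ (`|M| * (1 - x) `^ h)); first by rewrite ler_wpM2r ?powR_ge0// ler_norm.
  by rewrite ler_wpM2l// powR_sub_le.
- by case: r => dF sF; split => //; apply: IH sF; rewrite lerB.
Qed.

Lemma symbS N g F : symb N.+1 g F -> symb N g F.
Proof.
elim: N g F => [|N IH] g F [bF [dF sF]]; split => //; split => //.
exact: IH.
Qed.

Lemma symb_le N N' g F : (N' <= N)%N -> symb N g F -> symb N' g F.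
Proof. by move=> /subnK <-; elim: (N - N')%N => [//|k IH]; rewrite addSn => /symbS; exact: IH. Qed.

Lemma symb_eq N g F G : (forall x, 0 < x < 1 -> F x = G x) -> symb N g F -> symb N g G.
Proof.
elim: N g F G => [|N IH] g F G FG [[M HM] r]; split => //.
- by exists M => x x01; rewrite -FG//; exact: HM.
- by exists M => x x01; rewrite -FG//; exact: HM.
- case: r => dF sF; split; first by move=> x x01; apply: (derivable_eq_itv FG x01); exact: dF.
  by apply: IH sF => x x01; exact: derive1_eq_itv FG x01.
Qed.

Lemma symbD N g F G : symb N g F -> symb N g G -> symb N g (fun x => F x + G x).
Proof.
elim: N g F G => [|N IH] g F G [[M HM] rF] [[M' HM'] rG]; split => //.
- exists (M + M') => x x01; rewrite mulrDl; apply: le_trans (ler_normD _ _) _.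
  by apply: lerD; [exact: HM|exact: HM'].
- exists (M + M') => x x01; rewrite mulrDl; apply: le_trans (ler_normD _ _) _.
  by apply: lerD; [exact: HM|exact: HM'].
- case: rF => dF sF; case: rG => dG sG; split.
    by move=> x x01; apply: derivable_add; [exact: dF|exact: dG].
  apply: symb_eq (IH _ _ _ sF sG) => x x01.
  by rewrite derive1_add//; [exact: dF|exact: dG].
Qed.

Lemma symbM N g h F G : symb N g F -> symb N h G -> symb N (g + h) (fun x => F x * G x).
Proof.
elim: N g h F G => [|N IH] g h F G sF sG.
all: have [M HM] := symb_bound sF; have [M' HM'] := symb_bound sG.
all: split => //.
1,2: exists (M * M') => x x01; rewrite normrM powRD; last
  by apply/implyP => _; case/andP: x01 => _ x1; rewrite subr_eq0 gt_eqF.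
1,2: by rewrite mulrACA; apply: ler_pM => //; [exact: HM|exact: HM'].
split; first by move=> x x01; apply: derivable_mul; [exact: (symb_derivable sF)|exact: (symb_derivable sG)].
have e1 : g - 1 + h = g + h - 1 by ring.
have e2 : g + (h - 1) = g + h - 1 by ring.
have s1 : symb N (g + h - 1) (fun x => derive1 F x * G x).
  by rewrite -e1; apply: IH; [exact: symb_derive1|exact: symbS].
have s2 : symb N (g + h - 1) (fun x => F x * derive1 G x).
  by rewrite -e2; apply: IH; [exact: symbS|exact: symb_derive1].
apply: symb_eq (symbD s1 s2) => x x01.
by rewrite derive1_mul//; [exact: (symb_derivable sF)|exact: (symb_derivable sG)].
Qed.

Lemma symb_const N c : symb N 0 (fun=> c).
Proof.
elim: N c => [|N IH] c; split => //.
- by exists `|c| => x _; rewrite powRr0 mulr1.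
- by exists `|c| => x _; rewrite powRr0 mulr1.
split; first by move=> x _; exact: derivable_const.
by rewrite derive1_const; apply: symb_weaken (IH 0); lra.
Qed.

Lemma symbZ N g c F : symb N g F -> symb N g (fun x => c * F x).
Proof. by move=> sF; have := symbM (symb_const N c) sF; rewrite add0r. Qed.

Lemma symb_powR_sub N g : symb N g (fun x => (1 - x) `^ g).
Proof.
elim: N g => [|N IH] g; split => //.
- by exists 1 => x _; rewrite mul1r ger0_norm// powR_ge0.
- by exists 1 => x _; rewrite mul1r ger0_norm// powR_ge0.
split; first by move=> x /andP[_ x1]; exact: derivable_powR_sub.
apply: symb_eq (symbZ (- g) (IH (g - 1))) => x /andP[_ x1].
by rewrite derive1_powR_sub.
Qed.

(** On (0,1) the base 1+x lies between 1 and 2, so 2^|g| bounds the power for either sign of [g]. *)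
Lemma symb_powR_add N g : symb N 0 (fun x => (1 + x) `^ g).
Proof.
have bd h x : 0 < x < 1 -> `|(1 + x) `^ h| <= 2 `^ `|h| * (1 - x) `^ 0.
  move=> /andP[x0 x1]; rewrite powRr0 mulr1 ger0_norm ?powR_ge0//.
  apply: (@le_trans _ _ ((1 + x) `^ `|h|)).
    by apply: ler_powR; [lra|exact: ler_norm].
  by apply: ge0_ler_powR; rewrite ?nnegrE//; lra.
elim: N g => [|N IH] g; split => //.
- by exists (2 `^ `|g|) => x; exact: bd.
- by exists (2 `^ `|g|) => x; exact: bd.
split; first by move=> x /andP[x0 _]; apply: derivable_powR_add; rewrite (lt_trans _ x0)//; lra.
apply: (@symb_eq _ _ (fun x => g * (1 + x) `^ (g - 1))).
  by move=> x /andP[x0 _]; rewrite derive1_powR_add//; lra.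
by apply: symbZ; apply: symb_weaken (IH (g - 1)); lra.
Qed.

(** Since g < 0, (1-x)^g >= 1 on (0,1), and the constant of integration is absorbed by the bound. *)
Lemma symb_primitive N g F : g < 0 ->
  (forall x, 0 < x < 1 -> derivable F x 1) -> symb N (g - 1) (derive1 F) ->
  symb N.+1 g F.
Proof.
move=> g0 dF sF; split => //.
have [M0 HM0] := symb_bound sF.
pose M := `|M0|.
have HM x : 0 < x < 1 -> `|derive1 F x| <= M * (1 - x) `^ (g - 1).
  move=> x01; apply: le_trans (HM0 _ x01) _.
  by rewrite ler_wpM2r ?powR_ge0// ler_norm.
(* With this [A], the function A (1-x)^g is a primitive of M (1-x)^(g-1), hence a majorant for the
   increments of [F]. *)
pose A := M / (- g); have A0 : 0 <= A by apply: divr_ge0; [exact: normr_ge0|rewrite oppr_ge0 ltW].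
have ng0 : - g != 0 by rewrite oppr_eq0 lt_eqF.
pose H x := A * (1 - x) `^ g.
have dH x : 0 < x < 1 -> derivable H x 1.
  move=> /andP[_ x1]; apply: derivable_mul; first exact: derivable_const.
  exact: derivable_powR_sub.
have H' x : 0 < x < 1 -> `|derive1 F x| <= derive1 H x.
  move=> x01; rewrite derive1_mul; last first.
  - by apply: derivable_powR_sub; case/andP: x01.
  - exact: derivable_const.
  rewrite derive1_const mul0r add0r derive1_powR_sub; last by case/andP: x01.
  by rewrite mulrA /A mulfVK//; exact: HM.
have incr x y := @le_derive1_increment R 0 1 F H x y dF dH H'.
have t1 x : 0 < x < 1 -> 1 <= (1 - x) `^ g.
  by move=> x01; rewrite -[leLHS](powRr0 (1 - x)); apply: powR_sub_le => //; exact: ltW.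
pose c : R := 2^-1.
have c01 : 0 < c < 1 by apply/andP; rewrite /c; split; lra.
exists (`|F c| + A * (1 - c) `^ g) => x x01.
have tx := t1 x x01; have tc := t1 c c01.
have key : `|F x - F c| <= A * (1 - c) `^ g * (1 - x) `^ g.
  have [xc|cx] := leP x c.
    rewrite distrC; apply: le_trans (incr x c _ xc _) _; [by case/andP: x01|by case/andP: c01|].
    apply: (@le_trans _ _ (A * (1 - c) `^ g)).
      by rewrite /H gerBl mulr_ge0// (le_trans _ tx).
    by rewrite ler_peMr// mulr_ge0// (le_trans _ tc).
  apply: le_trans (incr c x _ (ltW cx) _) _; [by case/andP: c01|by case/andP: x01|].
  apply: (@le_trans _ _ (A * (1 - x) `^ g)).
    by rewrite /H gerBl mulr_ge0// (le_trans _ tc).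
  by rewrite (mulrAC A) ler_peMr// mulr_ge0// (le_trans _ tx).
rewrite mulrDl -lerBlDl; apply: le_trans key.
apply: le_trans (lerB_dist _ _).
by apply: lerB => //; apply: ler_peMr.
Qed.

(** The borderline exponent: a derivative that is only O((1-x)^(-1)) could have a logarithmic
    primitive, so O(1) is asked of it; the constant of integration keeps the exponent of [F] at
    0. *)
Lemma symb0_primitive N F :
  (forall x, 0 < x < 1 -> derivable F x 1) -> symb N 0 (derive1 F) ->
  symb N.+1 0 F.
Proof.
move=> dF sF; split; last by split => //; apply: symb_weaken sF; lra.
have [M HM] := symb_bound sF.
pose c : R := 2^-1.
have c01 : 0 < c < 1 by apply/andP; rewrite /c; split; lra.
have bd x : 0 < x < 1 -> `|derive1 F x| <= M.
  by move=> /HM; rewrite powRr0 mulr1.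
have M0 : 0 <= M by exact: le_trans (bd c c01).
exists (`|F c| + M) => x x01; rewrite powRr0 mulr1 -lerBlDl.
apply: le_trans (lerB_dist _ _) _.
apply: le_trans (bounded_derive1_increment dF bd c01 x01) _.
rewrite ler_piMr// ler_norml; case/andP: x01 => ? ?; case/andP: c01 => ? ?.
by apply/andP; split; lra.
Qed.

Lemma symb_cvg0 g F : 0 < g -> symb 0 g F -> F x @[x --> 1^'-] --> 0.
Proof.
move=> g0 [[M HM] _].
have pc : (1 - x) `^ g @[x --> (1 : R)^'-] --> 0.
  apply: (@cvg_comp _ _ _ (fun x : R => 1 - x) (fun y => y `^ g) _ (0^'+)); last exact: powR_cvg0.
  move=> P [e /= e0 He]; exists e => //= x /= xe x1; apply: He => /=; last by rewrite subr_gt0.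
  by rewrite sub0r normrN.
have Mc : M * (1 - x) `^ g @[x --> (1 : R)^'-] --> 0.
  by rewrite -(mulr0 M); apply: cvgM => //; exact: cvg_cst.
have Mc' : - (M * (1 - x) `^ g) @[x --> (1 : R)^'-] --> 0.
  by rewrite -oppr0; exact: cvgN.
apply: (squeeze_cvgr _ Mc' Mc); near=> x; rewrite -ler_norml; apply: HM.
by apply/andP; split; near: x; [exact: nbhs_left_gt|exact: nbhs_left_lt].
Unshelve. all: by end_near. Qed.

End symbols.

(** * The Jacobi expression for real functions *)

Section real_jacobi.
Context {R : realType} (alpha beta : R).
Implicit Types (x y M g : R) (F G u v : R -> R) (C : nat -> R) (k m n N K : nat).

Definition rjac_flux u : R -> R := fun x =>
  (1 - x) `^ (alpha + 1) * (1 + x) `^ (beta + 1) * derive1 u x.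

Definition rjac u : R -> R := fun x =>
  - (jweight alpha beta x)^-1 * derive1 (rjac_flux u) x.

Definition rjacn m u := iter m rjac u.

Fixpoint rquasi n C u k : R -> R :=
  match k with
  | 0 => fun x => acoef alpha beta C n x * derive1n n u x
  | k'.+1 => fun x => acoef alpha beta C (n - k) x * derive1n (n - k) u x
      - derive1 (rquasi n C u k') x
  end.

Definition rsesq n C u v : R -> R := fun x =>
  \sum_(1 <= k < n.+1) \sum_(1 <= j < k.+1) (-1) ^+ (k + j) *
    (derive1n (k - j) (fun y => acoef alpha beta C k y * derive1n k v y) x
       * derive1n j.-1 u x
     - derive1n (k - j) (fun y => acoef alpha beta C k y * derive1n k u y) x
       * derive1n j.-1 v x).

Lemma jweight_gt0 x : -1 < x < 1 -> 0 < jweight alpha beta x.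
Proof.
move=> /andP[x1 x2]; rewrite /jweight mulr_gt0// powR_gt0//; lra.
Qed.

Lemma csmooth_acoef C k : csmooth (acoef alpha beta C k).
Proof.
apply: csmoothM; last exact: csmooth_powR_add.
by apply: csmoothM; [exact: csmooth_const|exact: csmooth_powR_sub].
Qed.

Lemma symb_acoef C k N : symb N (alpha + k%:R) (acoef alpha beta C k).
Proof.
have := symbM (symbM (symb_const N (C k)) (symb_powR_sub N (alpha + k%:R)))
  (symb_powR_add N (beta + k%:R)).
by rewrite add0r addr0.
Qed.

Lemma symb_jweight N : symb N alpha (jweight alpha beta).
Proof.
have := symbM (symb_powR_sub N alpha) (symb_powR_add N beta).
by rewrite addr0.
Qed.

(** The definition of [rjac] solved for the derivative. As [derive1] is total, this is an algebraic
    identity at every interior point. *)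
Lemma derive1_rjac_flux u x : -1 < x < 1 ->
  derive1 (rjac_flux u) x = - jweight alpha beta x * rjac u x.
Proof.
move=> xI; rewrite /rjac mulrA mulrNN mulfV ?mul1r//.
by rewrite gt_eqF// jweight_gt0.
Qed.

(** * Iterates and quasi-derivatives as differential expressions in [u] *)

Section derivatives.
Variables (u : R -> R) (K : nat).
Hypothesis du : forall k y, (k < K)%N -> -1 < y < 1 -> derivable (derive1n k u) y 1.

Lemma diffexp_rjac_flux N F : (N < K)%N -> diffexp u N F -> diffexp u N.+1 (rjac_flux F).
Proof.
move=> NK dF; apply: diffexpM; last exact: diffexp_derive1 NK du dF.
by apply: csmoothM; [exact: csmooth_powR_sub|exact: csmooth_powR_add].
Qed.

Lemma diffexp_rjac N F : (N.+1 < K)%N -> diffexp u N F -> diffexp u N.+2 (rjac F).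
Proof.
move=> NK dF.
apply: (@diffexp_eq _ _ _ (fun x => -1 * ((1 - x) `^ (- alpha) * (1 + x) `^ (- beta)) *
    derive1 (rjac_flux F) x)).
  by move=> x xI; rewrite /rjac /jweight invfM !powRN mulN1r.
apply: diffexpM; last first.
  by apply: (diffexp_derive1 NK du); apply: diffexp_rjac_flux => //; exact: ltnW.
apply: csmoothM; first exact: csmooth_const.
by apply: csmoothM; [exact: csmooth_powR_sub|exact: csmooth_powR_add].
Qed.

Lemma diffexp_rjacn m : (m.*2 <= K)%N -> diffexp u m.*2 (rjacn m u).
Proof.
elim: m => [|m IH] mK; first exact: (@diffexp_base _ u 0 0).
by rewrite doubleS; apply: diffexp_rjac => //; apply: IH; lia.
Qed.

Lemma diffexp_rquasi n C k : (k < n)%N -> (n + k <= K)%N ->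
  diffexp u (n + k) (rquasi n C u k).
Proof.
elim: k => [|k IH] kn nK.
  by apply: diffexpM; [exact: csmooth_acoef|apply: diffexp_base; rewrite addn0].
apply: diffexpB.
  by apply: diffexpM; [exact: csmooth_acoef|apply: diffexp_base; lia].
rewrite addnS; apply: (@diffexp_derive1 _ u K) => //; first by rewrite -addnS.
by apply: IH; lia.
Qed.

Lemma diffexp_term C n i : (n + i <= K)%N ->
  diffexp u (n + i) (derive1n i (fun y => acoef alpha beta C n y * derive1n n u y)).
Proof.
move=> nK; apply: (@diffexp_derive1n _ u K) => //.
by apply: diffexpM; [exact: csmooth_acoef|exact: diffexp_base].
Qed.

Lemma derive1_sum (s : seq nat) (f : nat -> R -> R) x :
  (forall i, i \in s -> derivable (f i) x 1) ->
  derivable (fun y => \sum_(i <- s) f i y) x 1 /\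
  derive1 (fun y => \sum_(i <- s) f i y) x = \sum_(i <- s) derive1 (f i) x.
Proof.
elim: s => [|i s IH] df.
  have -> : (fun y : R => \sum_(i <- [::]) f i y) = (fun=> 0).
    by apply/funext => y; rewrite big_nil.
  by rewrite big_nil derive1_const; split => //; exact: derivable_const.
have -> : (fun y : R => \sum_(i <- i :: s) f i y) = (fun y => f i y + \sum_(i <- s) f i y).
  by apply/funext => y; rewrite big_cons.
have [dS ES] : _ /\ _ := IH (fun j js => df j (mem_behead (s := i :: s) js)).
have di : derivable (f i) x 1 by apply: df; rewrite inE eqxx.
by split; [exact: derivable_add|rewrite derive1_add// big_cons ES].
Qed.

(** The unfolded recursion. It is the inner sum of the sesquilinear form once the summations are
    exchanged, and for k = n-1 its derivative is, up to sign, the sum in the identity for the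
    constants. *)
Lemma rquasi_sum n C k x : (k < n)%N -> (n + k <= K)%N -> -1 < x < 1 ->
  rquasi n C u k x = \sum_(n - k <= i < n.+1) (-1) ^+ (i - (n - k)) *
    derive1n (i - (n - k)) (fun y => acoef alpha beta C i y * derive1n i u y) x.
Proof.
elim: k x => [|k IH] x kn nK xI.
  by rewrite subn0 big_nat1 subnn expr0 mul1r.
rewrite [LHS]/= big_ltn; last lia.
rewrite subnn expr0 mul1r; congr (_ + _).
have kn' : (k < n)%N by lia.
have nK' : (n + k <= K)%N by lia.
rewrite (derive1_eq_itv (fun y yI => IH y kn' nK' yI) xI).
rewrite [in LHS](derive1_sum (f := fun i y => (-1) ^+ (i - (n - k)) *
  derive1n (i - (n - k)) (fun y => acoef alpha beta C i y * derive1n i u y) y) _).2; last first.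
  move=> i; rewrite mem_index_iota => /andP[ki iN]; apply: derivable_mul; first exact: derivable_const.
  apply: (@diffexp_derivable _ u K (i + (i - (n - k)))) => //; first lia.
  by apply: diffexp_term; lia.
rewrite -sumrN; have -> : (n - k.+1).+1 = (n - k)%N by lia.
apply: eq_big_nat => i /andP[ki iN].
rewrite derive1_mul; last first.
- apply: (@diffexp_derivable _ u K (i + (i - (n - k)))) => //; first lia.
  by apply: diffexp_term; lia.
- exact: derivable_const.
rewrite derive1_const mul0r add0r -derive1nS.
have -> : (i - (n - k.+1))%N = (i - (n - k)).+1 by lia.
by rewrite exprS mulN1r mulNr.
Qed.

End derivatives.

(** * Behaviour at the endpoint 1 *)

Section endpoint_one.
Hypothesis alpha_gt0 : 0 < alpha.

(** Division by (1-x)^(alpha+1) gives F' the exponent -alpha-1; as alpha > 0, integration raises it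
    to -alpha. *)
Lemma symb_of_rjac_flux N F : (forall x, 0 < x < 1 -> derivable F x 1) ->
  symb N 0 (rjac_flux F) -> symb N.+1 (- alpha) F.
Proof.
move=> dF sP; apply: symb_primitive => //; first by rewrite oppr_lt0.
have := symbM (symbM (symb_powR_sub N (- (alpha + 1))) (symb_powR_add N (- (beta + 1)))) sP.
rewrite !addr0 => h; have -> : - alpha - 1 = - (alpha + 1) by ring.
apply: symb_eq h => x /andP[x0 x1].
rewrite /rjac_flux !powRN -invfM mulKf// mulf_neq0// gt_eqF// powR_gt0//; lra.
Qed.

(** The weight has exponent alpha and cancels the singularity of [rjac F], so the flux has a
    derivative of exponent 0. *)
Lemma symb_rjac_flux N F : (forall x, 0 < x < 1 -> derivable (rjac_flux F) x 1) ->
  symb N (- alpha) (rjac F) -> symb N.+1 0 (rjac_flux F).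
Proof.
move=> dP sF; apply: symb0_primitive => //.
have := symbZ (-1) (symbM (symb_jweight N) sF).
rewrite addrN; apply: symb_eq => x /andP[x0 x1].
rewrite derive1_rjac_flux; first by rewrite mulN1r mulNr.
by apply/andP; split; lra.
Qed.

(** Descent from l^(n-1)[u], controlled to order 1, down to [u]: each step gains one order in
    passing to the flux and one more in passing to the function under it, which makes 1 + 2(n-1) =
    2n-1 orders, always with exponent -alpha. *)
Lemma symb_of_bounded_flux n u : (0 < n)%N ->
  (forall k y, (k.+1 < n.*2)%N -> -1 < y < 1 -> derivable (derive1n k u) y 1) ->
  (exists M, forall x, 0 < x < 1 -> `|rjac_flux (rjacn n.-1 u) x| <= M) ->
  symb n.*2.-1 (- alpha) u.
Proof.
move=> n0 du [M HM].
have du' k y : (k < n.*2.-1)%N -> -1 < y < 1 -> derivable (derive1n k u) y 1.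
  by move=> kn; apply: du; lia.
have sub x : 0 < x < 1 -> -1 < x < 1 by move=> /andP[? ?]; apply/andP; split; lra.
have main j : (j < n)%N -> symb (j.*2.+1) (- alpha) (rjacn (n.-1 - j) u).
  elim: j => [|j IH] jn.
    rewrite subn0; apply: symb_of_rjac_flux.
      move=> x /sub xI; apply: (@diffexp_derivable _ u n.*2.-1 n.-1.*2) => //; first lia.
      by apply: (diffexp_rjacn du'); lia.
    by split => //; exists M => x /HM; rewrite powRr0 mulr1.
  rewrite doubleS; apply: symb_of_rjac_flux.
    move=> x /sub xI; apply: (@diffexp_derivable _ u n.*2.-1 (n.-1 - j.+1).*2) => //; first lia.
    by apply: (diffexp_rjacn du'); lia.
  apply: symb_rjac_flux.
    move=> x /sub xI; apply: (@diffexp_derivable _ u n.*2.-1 (n.-1 - j.+1).*2.+1) => //; first lia.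
    apply: (diffexp_rjac_flux du'); first lia.
    by apply: (diffexp_rjacn du'); lia.
  rewrite -[rjac _]/(rjacn (n.-1 - j.+1).+1 u).
  have -> : (n.-1 - j.+1).+1 = (n.-1 - j)%N by lia.
  by apply: IH; lia.
have := main n.-1; have -> : (n.-1 < n)%N by lia.
by rewrite subnn => /(_ isT); have -> : n.-1.*2.+1 = n.*2.-1 by lia.
Qed.

Lemma derive1n_monomial m k :
  derive1n k (fun x : R => (1 - x) ^+ m) =
  (fun x => (-1) ^+ k * (m ^_ k)%:R * (1 - x) ^+ (m - k)).
Proof.
elim: k => [|k IH].
  by rewrite derive1n0; apply/funext => x; rewrite expr0 ffactn0 !mul1r subn0.
rewrite derive1nS IH; apply/funext => x.
have d1 : is_derive x 1 (fun y : R => 1 - y) (- 1).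
  have := @is_deriveB R R^o R^o (cst 1) id x 1 0 1 _ _.
  by rewrite sub0r; apply.
have dn : is_derive x 1 (fun y : R => (1 - y) ^+ (m - k)) (- ((m - k)%:R * (1 - x) ^+ (m - k).-1)).
  have := @is_derive1_comp R (fun a : R => a ^+ (m - k)) (fun y => 1 - y) x
    ((m - k)%:R * (1 - x) ^+ (m - k).-1) (-1) _ d1.
  rewrite mulrN1; apply.
  apply: DeriveDef; first exact: exprn_derivable.
  by rewrite exp_derive [_ *: 1]mulr1.
rewrite derive1_mul; [|exact: derivable_const|by case: dn].
rewrite derive1_const mul0r add0r derive1E (@derive_val _ _ _ _ _ _ _ dn).
rewrite exprS ffactnSr natrM subnS.
ring.
Qed.

(** The form is defined with [k] outside; the quasi-derivatives appear when [j] is fixed and [k]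
    runs from [j] to [n]. *)
Lemma sum_triangle n (f : nat -> nat -> R) :
  \sum_(1 <= k < n.+1) \sum_(1 <= j < k.+1) f k j =
  \sum_(1 <= j < n.+1) \sum_(j <= k < n.+1) f k j.
Proof.
elim: n => [|n IH]; first by rewrite !big_geq.
rewrite big_nat_recr//= IH [RHS]big_nat_recr//= big_nat1.
rewrite [X in _ + X = _](big_nat_recr n.+1)//= addrA; congr (_ + _).
rewrite -big_split; apply: eq_big_nat => j /andP[_ jn].
by rewrite [RHS]big_nat_recr//=; lia.
Qed.

Lemma cvg_sum_seq (T : Type) (Fl : set_system T) (FF : Filter Fl) (s : seq nat)
    (f : nat -> T -> R) (l : nat -> R) :
  (forall i, i \in s -> f i z @[z --> Fl] --> l i) ->
  \sum_(i <- s) f i z @[z --> Fl] --> \sum_(i <- s) l i.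
Proof.
elim: s => [|i s IH] fl.
  rewrite big_nil [X in X @ _ --> _](_ : _ = fun=> 0); first exact: cvg_cst.
  by apply/funext => x; rewrite big_nil.
rewrite big_cons [X in X @ _ --> _](_ : _ = fun z : T => f i z + \sum_(i <- s) f i z); last first.
  by apply/funext => x; rewrite big_cons.
apply: cvgD; first by apply: fl; rewrite inE eqxx.
by apply: IH => j js; apply: fl; rewrite inE js orbT.
Qed.

(* Only the boundary behaviour of the flux of [rjacn n.-1 u] and of the top
   quasi-derivative is needed; both come from absolute continuity. *)
Lemma cvg_quasi_sesq_at_one n C u s : (1 <= s <= n)%N ->
  (forall k y, (k.+1 < n.*2)%N -> -1 < y < 1 -> derivable (derive1n k u) y 1) ->
  (exists M, forall x, 0 < x < 1 -> `|rjac_flux (rjacn n.-1 u) x| <= M) ->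
  cvg (rquasi n C u n.-1 x @[x --> 1^'-]) ->
  exists L, rquasi n C u (n - s) x @[x --> 1^'-] --> L /\
    rsesq n C u (fun y => (1 - y) ^+ s.-1) x @[x --> 1^'-] --> (-1) ^+ s * (s.-1)`!%:R * L.
Proof.
move=> /andP[s1 sn] du bP cQ.
have n0 : (0 < n)%N by lia.
have su := symb_of_bounded_flux n0 du bP.
have du' k y : (k < n.*2.-1)%N -> -1 < y < 1 -> derivable (derive1n k u) y 1.
  by move=> kn; apply: du; lia.
have sub x : 0 < x < 1 -> -1 < x < 1 by move=> /andP[? ?]; apply/andP; split; lra.
have suk k N : (N + k <= n.*2.-1)%N -> symb N (- alpha - k%:R) (derive1n k u).
  by move=> kN; apply: symb_derive1n; apply: symb_le su.
have cq j : (1 <= j <= n)%N -> cvg (rquasi n C u (n - j) x @[x --> 1^'-]).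
  elim: j => // -[|j] IH jn; first by rewrite subn1.
  have {}IH := IH _; have {IH} : cvg (rquasi n C u (n - j.+1) x @[x --> 1^'-]) by apply: IH; lia.
  move=> /bounded_near_cvg[N /(at_left_witness (@ltr01 R))[c /andP[c0 c1] Hc]].
  (* The exponents alpha + k of a_k and -alpha - k of the k-th derivative cancel. *)
  have sau : symb 0 0 (fun x => acoef alpha beta C j.+1 x * derive1n j.+1 u x).
    have e : (alpha + j.+1%:R) + (- alpha - j.+1%:R) = 0 by ring.
    by rewrite -[X in symb _ X]e; apply: symbM; [exact: symb_acoef|apply: suk; lia].
  have [M HM] := symb_bound sau.
  (* Below the top order the derivative is a difference of two functions bounded near 1, so a
     Lipschitz argument suffices. *)
  apply: (@cvg_at_left_bounded_derive1 R c 1 _ (M + N) c1).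
    move=> z /andP[cz z1].
    have zI : -1 < z < 1 by apply: sub; rewrite z1 (lt_trans c0).
    have jK : (n + (n - j.+2) < n.*2.-1)%N by lia.
    have jn' : (n - j.+2 < n)%N by lia.
    exact: (diffexp_derivable jK zI du' (diffexp_rquasi du' C jn' (ltnW jK))).
  move=> z /andP[cz z1].
  have E : rquasi n C u (n - j.+1) z = acoef alpha beta C j.+1 z * derive1n j.+1 u z -
      derive1 (rquasi n C u (n - j.+2)) z.
    have -> : (n - j.+1 = (n - j.+2).+1)%N by lia.
    by rewrite /=; have -> : (n - (n - j.+2).+1 = j.+1)%N by lia.
  have -> : derive1 (rquasi n C u (n - j.+2)) z =
      acoef alpha beta C j.+1 z * derive1n j.+1 u z - rquasi n C u (n - j.+1) z.
    by rewrite E; ring.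
  apply: le_trans (ler_normB _ _) _; apply: lerD; last by apply: Hc; rewrite cz z1.
  by have := HM z; rewrite powRr0 mulr1 z1 (lt_trans c0 cz); apply.
have /cvg_ex[L qL] := cq s (introT andP (conj s1 sn)).
exists L; split => //.
pose v : R -> R := fun y => (1 - y) ^+ s.-1.
have sv k N : symb N (s.-1%:R - k%:R) (derive1n k v).
  apply: symb_derive1n; apply: (@symb_eq _ _ _ (fun x => (1 - x) `^ s.-1%:R)); last exact: symb_powR_sub.
  by move=> x /andP[_ x1]; rewrite powR_mulrn// subr_ge0 ltW.
have v0 k : (s.-1 < k)%N -> derive1n k v = fun=> 0.
  move=> sk; rewrite /v derive1n_monomial; apply/funext => x.
  by rewrite ffact_small// mulr0 mul0r.
have vs : derive1n s.-1 v = fun=> (-1) ^+ s.-1 * (s.-1)`!%:R.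
  by rewrite /v derive1n_monomial; apply/funext => x; rewrite ffactnn subnn expr0 mulr1.
(* [T2] is grouped into quasi-derivatives of [u], whose limits are known; [T1] stays a double sum
   because its terms are estimated one by one. *)
pose T1 x := \sum_(1 <= k < n.+1) \sum_(1 <= j < k.+1) (-1) ^+ (k + j) *
    (derive1n (k - j) (fun y => acoef alpha beta C k y * derive1n k v y) x * derive1n j.-1 u x).
pose T2 x := \sum_(1 <= j < n.+1) rquasi n C u (n - j) x * derive1n j.-1 v x.
have TE x : 0 < x < 1 -> T1 x - T2 x = rsesq n C u v x.
  move=> /sub xI; rewrite /T1 /T2 /rsesq.
  under [RHS]eq_bigr do under eq_bigr do rewrite mulrBr.
  under [RHS]eq_bigr do rewrite sumrB.
  rewrite sumrB; congr (_ - _).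
  rewrite sum_triangle; apply: eq_big_nat => j /andP[j1 jn].
  rewrite (rquasi_sum du'); [|lia|lia|exact: xI].
  rewrite subKn; last lia.
  rewrite mulr_suml; apply: eq_big_nat => k /andP[jk kn].
  rewrite mulrA; congr (_ * _ * _).
  (* The numbers k+j and k-j have the same parity. *)
  by rewrite -signr_odd oddB// -oddD signr_odd.
have cT1 : T1 x @[x --> 1^'-] --> 0.
  have cT1k k : (1 <= k < n.+1)%N -> \sum_(1 <= j < k.+1) (-1) ^+ (k + j) *
    (derive1n (k - j) (fun y => acoef alpha beta C k y * derive1n k v y) x *
      derive1n j.-1 u x) @[x --> 1^'-] --> 0.
    move=> /andP[k1 kn].
    rewrite -[X in _ --> X](_ : \sum_(1 <= j < k.+1) (0 : R) = 0); last by rewrite big1.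
    apply: cvg_sum_seq => j; rewrite mem_index_iota => /andP[j1 jk].
    have [ks|sk] := leqP k s.-1; last first.
      rewrite [X in X @ _ --> _](_ : _ = fun=> 0); first exact: cvg_cst.
      apply/funext => y; rewrite v0//.
      have -> : (fun y => acoef alpha beta C k y * 0) = (fun=> 0 : R).
        by apply/funext => z; rewrite mulr0.
      suff -> : derive1n (k - j) (fun=> 0 : R) = (fun=> 0) by rewrite mul0r mulr0.
      by elim: (k - j)%N => // i IH; rewrite derive1nS IH derive1_const.
    (* Here k < s. The product a_k v^(k) has exponent alpha + s - 1, its k-j further derivatives
       cost k-j, and u^(j-1) contributes -alpha - (j-1): the total is s - k > 0. *)
    apply: (@symb_cvg0 _ (s.-1%:R - k%:R + 1)).
      by rewrite ltr_wpDl// subr_ge0 ler_nat.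
    apply: symbZ.
    have e : (alpha + k%:R + (s.-1%:R - k%:R) - (k - j)%:R) + (- alpha - (j.-1)%:R) =
        s.-1%:R - k%:R + 1.
      have ej : j%:R = (j.-1)%:R + 1 :> R by rewrite natr1 prednK.
      by rewrite natrB// ej; ring.
    rewrite -e; apply: symbM; last by apply: suk; lia.
    by apply: symb_derive1n; apply: symbM => //; exact: symb_acoef.
  rewrite -[X in _ --> X](_ : \sum_(1 <= k < n.+1) (0 : R) = 0); last by rewrite big1.
  by apply: cvg_sum_seq => k; rewrite mem_index_iota; exact: cT1k.
have cT2 : T2 x @[x --> 1^'-] --> (-1) ^+ s.-1 * (s.-1)`!%:R * L.
  have -> : (-1) ^+ s.-1 * (s.-1)`!%:R * L = \sum_(1 <= j < n.+1)
      (if j == s then (-1) ^+ s.-1 * (s.-1)`!%:R * L else 0).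
    by rewrite -big_mkcond big_nat1_eq s1 ltnS sn.
  apply: cvg_sum_seq => j; rewrite mem_index_iota ltnS => jn.
  have [->|js] := eqVneq j s.
    rewrite vs [X in _ --> X]mulrC; apply: (cvgM qL); exact: cvg_cst.
  have [js'|sj] := ltnP j s.
    have /cvg_ex[l ql] := cq j jn.
    rewrite -[X in _ --> X](mulr0 l); apply: cvgM => //.
    apply: (@symb_cvg0 _ (s.-1%:R - j.-1%:R)) => //.
    by rewrite subr_gt0 ltr_nat; lia.
  rewrite v0; last lia.
  rewrite [X in X @ _ --> _](_ : _ = fun=> 0); first exact: cvg_cst.
  by apply/funext => x; rewrite mulr0.
have -> : (-1) ^+ s * (s.-1)`!%:R * L = 0 - (-1) ^+ s.-1 * (s.-1)`!%:R * L :> R.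
  by rewrite -{1}(prednK s1) exprS; ring.
have : T1 x - T2 x @[x --> 1^'-] --> 0 - (-1) ^+ s.-1 * (s.-1)`!%:R * L by exact: cvgB.
apply: cvg_trans; apply: near_eq_cvg; near=> x.
rewrite -TE //; apply/andP; split; near: x; [exact: nbhs_left_gt|exact: nbhs_left_lt].
Unshelve. all: by end_near. Qed.

End endpoint_one.
End real_jacobi.

(** * The reflection x -> -x, which exchanges alpha and beta *)

Section reflection.
Context {R : realType}.
Implicit Types (x y M : R) (F G u v : R -> R) (C : nat -> R) (k m n : nat).

(* Both sides are 0 where [F] is not differentiable. *)
Lemma derive1_reflect F : derive1 (fun x => F (- x)) = (fun x => - derive1 F (- x)).
Proof.
apply/funext => x.
have dN (y : R) : is_derive y 1 (fun y : R => - y) (-1).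
  have := @is_deriveN R R^o R^o id y 1 1 _; apply.
have [dF|ndF] := pselect (derivable F (- x) 1).
  have h : is_derive (- x) 1 F (derive1 F (- x)) by exact: is_derive1_derive1.
  have [_ E] := @is_derive1_comp R F (fun y => - y) x _ _ h (dN x).
  by rewrite -mulrN1 -[RHS]E derive1E.
have ndF' : ~ derivable (fun y => F (- y)) x 1.
  move=> dF'; apply: ndF.
  have h : is_derive (- - x) 1 (fun y => F (- y)) (derive1 (fun y => F (- y)) (- - x)).
    by apply: is_derive1_derive1; rewrite opprK.
  have [dc _] := @is_derive1_comp R (fun y => F (- y)) (fun y => - y) (- x) _ _ h (dN (- x)).
  suff E : (fun y => F (- y)) \o (fun y => - y) = F by rewrite -[X in derivable X _ _]E.
  by apply/funext => y /=; rewrite opprK.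
rewrite !derive1E /derive (dvgP ndF') (dvgP ndF).
by rewrite [LHS](_ : _ = 0)// [X in - X](_ : _ = 0)// oppr0.
Qed.

Lemma derive1_oppf F : derive1 (fun x => - F x) = (fun x => - derive1 F x).
Proof.
apply/funext => x; have [dF|ndF] := pselect (derivable F x 1).
  exact: derive1_opp.
have ndF' : ~ derivable (fun y => - F y) x 1.
  move=> /derivable_opp dF'; apply: ndF.
  suff E : (fun y => - - F y) = F by rewrite -[X in derivable X _ _]E.
  by apply/funext => y /=; rewrite opprK.
rewrite !derive1E /derive (dvgP ndF') (dvgP ndF).
by rewrite [LHS](_ : _ = 0)// [X in - X](_ : _ = 0)// oppr0.
Qed.

Lemma derive1_signr k F :
  derive1 (fun x => (-1) ^+ k * F x) = (fun x => (-1) ^+ k * derive1 F x).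
Proof.
rewrite -signr_odd; case: (odd k).
  have -> : (fun x => (-1) ^+ true * F x) = (fun x => - F x).
    by apply/funext => x; rewrite expr1 mulN1r.
  by rewrite derive1_oppf; apply/funext => x; rewrite expr1 mulN1r.
have -> : (fun x => (-1) ^+ false * F x) = F by apply/funext => x; rewrite expr0 mul1r.
by apply/funext => x; rewrite expr0 mul1r.
Qed.

Lemma derive1n_signr k m F :
  derive1n m (fun x => (-1) ^+ k * F x) = (fun x => (-1) ^+ k * derive1n m F x).
Proof. by elim: m => // m IH; rewrite !derive1nS IH derive1_signr. Qed.

Lemma derive1n_reflect k F :
  derive1n k (fun x => F (- x)) = (fun x => (-1) ^+ k * derive1n k F (- x)).
Proof.
elim: k => [|k IH].
  by rewrite !derive1n0; apply/funext => x; rewrite expr0 mul1r.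
rewrite !derive1nS IH derive1_signr derive1_reflect.
by apply/funext => x; rewrite exprS mulN1r mulNr mulrN.
Qed.

Lemma acoef_reflect (a b : R) C k x : acoef b a C k x = acoef a b C k (- x).
Proof. by rewrite /acoef opprK mulrAC. Qed.

Lemma rjac_flux_reflect (a b : R) F :
  rjac_flux b a (fun x => F (- x)) = (fun x => - rjac_flux a b F (- x)).
Proof.
apply/funext => x; rewrite /rjac_flux derive1_reflect opprK mulrN.
by rewrite [_ * (1 + x) `^ _]mulrC.
Qed.

Lemma rjac_reflect (a b : R) F :
  rjac b a (fun x => F (- x)) = (fun x => rjac a b F (- x)).
Proof.
apply/funext => x; rewrite /rjac rjac_flux_reflect derive1_oppf.
rewrite (derive1_reflect (rjac_flux a b F)) opprK /jweight opprK.
by rewrite [_ * (1 + x) `^ _]mulrC.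
Qed.

Lemma rjacn_reflect (a b : R) m F :
  rjacn b a m (fun x => F (- x)) = (fun x => rjacn a b m F (- x)).
Proof.
elim: m => [//|m IH].
have E (c d : R) G : rjacn c d m.+1 G = rjac c d (rjacn c d m G) by [].
rewrite !E IH; exact: (rjac_reflect a b (rjacn a b m F)).
Qed.

(** The two terms of the recursion receive the same sign because n-k and n+k have the same
    parity. *)
Lemma rquasi_reflect (a b : R) n C F k : (k <= n)%N ->
  rquasi b a n C (fun x => F (- x)) k =
  (fun x => (-1) ^+ (n + k) * rquasi a b n C F k (- x)).
Proof.
elim: k => [|k IH] kn; apply/funext => x /=.
  by rewrite derive1n_reflect acoef_reflect addn0 mulrCA.
rewrite IH 1?ltnW// derive1_signr (derive1_reflect (rquasi a b n C F k)).
rewrite derive1n_reflect acoef_reflect mulrBr mulrCA; congr (_ * _ - _).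
  rewrite -signr_odd -[in RHS]signr_odd; congr (_ ^+ nat_of_bool _).
  by rewrite oddB// oddD.
by rewrite addnS exprS mulN1r mulNr mulrN.
Qed.

(** In each product the k inner derivatives, the k-j outer ones and the j-1 on the other factor give
    2k-1 sign changes, an odd number; hence one global minus sign. *)
Lemma rsesq_reflect (a b : R) n C F G x :
  rsesq b a n C (fun x => F (- x)) (fun x => G (- x)) x = - rsesq a b n C F G (- x).
Proof.
rewrite /rsesq -sumrN; apply: eq_big_nat => k /andP[k1 kn].
rewrite -sumrN; apply: eq_big_nat => j /andP[j1 jk].
have term H : derive1n (k - j) (fun y => acoef b a C k y * derive1n k (fun x => H (- x)) y) x =
    (-1) ^+ k * ((-1) ^+ (k - j) *
      derive1n (k - j) (fun y => acoef a b C k y * derive1n k H y) (- x)).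
  have -> : (fun y => acoef b a C k y * derive1n k (fun x => H (- x)) y) =
      (fun y => (-1) ^+ k * (acoef a b C k (- y) * derive1n k H (- y))).
    by apply/funext => y; rewrite derive1n_reflect acoef_reflect mulrCA.
  by rewrite derive1n_signr (derive1n_reflect _ (fun y => acoef a b C k y * derive1n k H y)).
rewrite !term !derive1n_reflect.
have s : (-1) ^+ k * (-1) ^+ (k - j) * (-1) ^+ j.-1 = -1 :> R.
  rewrite -!exprD -signr_odd !oddD oddB// -addbA (addbC (odd k)).
  rewrite [X in (-1) ^+ nat_of_bool X](_ : _ = true) ?expr1//.
  by have := oddS j.-1; rewrite prednK// => ->; case: (odd k); case: (odd j.-1).
have key (e1 e2 e3 e4 p q r t : R) : e1 * (e2 * (e3 * p) * (e4 * r) - e2 * (e3 * q) * (e4 * t)) =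
  e1 * ((e2 * e3 * e4) * (p * r - q * t)) by ring.
by rewrite key s mulN1r mulrN.
Qed.

Lemma cvg_at_rightN1 F (l : R) : F x @[x --> (-1 : R)^'+] --> l <->
  F (- x) @[x --> (1 : R)^'-] --> l.
Proof. by rewrite at_rightN; split. Qed.

End reflection.

(** * Behaviour at the endpoint -1 *)

Section endpoint_minus_one.
Context {R : realType} (alpha beta : R).
Implicit Types (x y M : R) (F G u v : R -> R) (C : nat -> R) (k m n : nat).

Lemma cvg_quasi_sesq_at_minus_one n C u s : 0 < beta -> (1 <= s <= n)%N ->
  (forall k y, (k.+1 < n.*2)%N -> -1 < y < 1 -> derivable (derive1n k u) y 1) ->
  (exists M, forall x, -1 < x < 0 -> `|rjac_flux alpha beta (rjacn alpha beta n.-1 u) x| <= M) ->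
  cvg (rquasi alpha beta n C u n.-1 x @[x --> (-1 : R)^'+]) ->
  exists L, rquasi alpha beta n C u (n - s) x @[x --> (-1 : R)^'+] --> L /\
    rsesq alpha beta n C u (fun y => (1 + y) ^+ s.-1) x @[x --> (-1 : R)^'+] -->
      - (s.-1)`!%:R * L.
Proof.
move=> b0 sn du [M HM] /cvg_ex[l /cvg_at_rightN1 ql].
have s1n : (n - s <= n)%N by rewrite leq_subr.
have [] := @cvg_quasi_sesq_at_one R beta alpha b0 n C (fun x => u (- x)) s sn.
- move=> k y kn yI; rewrite derive1n_reflect.
  apply: derivable_mul; first exact: derivable_const.
  have d : derivable (derive1n k u) (- y) 1.
    by apply: du => //; case/andP: yI => ? ?; apply/andP; split; lra.
  have h : is_derive (- y) 1 (derive1n k u) (derive1 (derive1n k u) (- y)).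
    exact: is_derive1_derive1.
  by case: (@is_derive1_comp R _ (fun y => - y) y _ _ h (@is_deriveN R R^o R^o id y 1 1 _)).
- exists M => x /andP[x0 x1]; rewrite rjacn_reflect rjac_flux_reflect normrN.
  by apply: HM; apply/andP; split; lra.
- apply/cvg_ex; exists ((-1) ^+ (n + n.-1) * l).
  rewrite rquasi_reflect ?leq_pred//; apply: cvgM => //; exact: cvg_cst.
(* Reflection multiplies the quasi-derivative of order 2n-s by (-1)^s. This cancels the sign in the
   formula at 1 and leaves only the minus sign of the reflected form. *)
move=> L [qL sL]; exists ((-1) ^+ s * L); split.
  apply/cvg_at_rightN1.
  have -> : (fun x => rquasi alpha beta n C u (n - s) (- x)) =
      (fun x => (-1) ^+ s * rquasi beta alpha n C (fun x => u (- x)) (n - s) x).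
    apply/funext => x; rewrite rquasi_reflect// mulrA -exprD -signr_odd.
    have -> : odd (s + (n + (n - s))) = false by have /andP[? ?] := sn; lia.
    by rewrite expr0 mul1r.
  by apply: cvgM => //; exact: cvg_cst.
apply/cvg_at_rightN1.
have -> : (fun x => rsesq alpha beta n C u (fun y => (1 + y) ^+ s.-1) (- x)) =
    (fun x => - rsesq beta alpha n C (fun x => u (- x)) (fun y => (1 - y) ^+ s.-1) x).
  apply/funext => x.
  by rewrite (rsesq_reflect alpha beta n C u (fun y => (1 + y) ^+ s.-1)) opprK.
have -> : - (s.-1)`!%:R * ((-1) ^+ s * L) = - ((-1) ^+ s * (s.-1)`!%:R * L) :> R by ring.
exact: cvgN.
Qed.

End endpoint_minus_one.

(** * Boundary limits of the flux and of the top quasi-derivative *)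

Section endpoint_limits.
Context {R : realType}.
Implicit Types (a b c x y M : R) (F G u v : R -> R) (C : nat -> R) (k m n : nat).
Local Notation mu := (@lebesgue_measure R).

Lemma bounded_of_cvg_endpoints a b G : a < b ->
  (forall x y, a < x -> x < y -> y < b -> abs_cont x y G) ->
  cvg (G x @[x --> b^'-]) -> cvg (G x @[x --> a^'+]) ->
  exists M, forall x, a < x < b -> `|G x| <= M.
Proof.
move=> ab acG /bounded_near_cvg[M1 /(at_left_witness ab)[c /andP[ac cb] Hc]].
move=> /bounded_near_cvg[M2 /(at_right_witness ac)[d /andP[ad dc] Hd]].
have [M3 HM] := abs_cont_bounded (ltW dc) (acG _ _ ad dc cb).
exists (Num.max M1 (Num.max M2 M3)) => x /andP[ax xb]; rewrite !le_max.
have [cx|xc] := ltP c x; first by rewrite Hc// cx.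
have [xd|dx] := ltP x d; first by rewrite (Hd x) ?ax ?xd ?orbT.
by rewrite HM ?dx ?orbT.
Qed.

Variables (alpha beta : R).

Lemma jweight_continuous x : -1 < x < 1 -> {for x, continuous (jweight alpha beta)}.
Proof.
move=> /andP[x1 x2]; apply: derivable_continuous; apply: derivable_mul.
  exact: derivable_powR_sub.
exact: derivable_powR_add.
Qed.

Lemma jweight_measurable : measurable_fun `](-1 : R), 1[ (jweight alpha beta).
Proof.
apply: open_continuous_measurable_fun => //.
by move=> x; rewrite inE/= in_itv/=; exact: jweight_continuous.
Qed.

(** Both functions are differential expressions of order 2n-1 in [u], hence locally absolutely
    continuous. The derivative of the flux is -w l^n[u] by definition, that of the quasi-derivative
    by the identity for the constants, wherever u^(2n-1) is differentiable; so u^(2n-1) is the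
    auxiliary function [U]. *)
Lemma flux_quasi_endpoints n C u : (0 < n)%N ->
  (forall k y, (k.+1 < n.*2)%N -> -1 < y < 1 -> derivable (derive1n k u) y 1) ->
  (forall k x y, (k < n.*2)%N -> -1 < x -> x < y -> y < 1 -> abs_cont x y (derive1n k u)) ->
  mu.-integrable `](-1 : R), 1[ (EFin \o (fun x => jweight alpha beta x * rjacn alpha beta n u x)) ->
  (forall x, -1 < x < 1 -> derivable (derive1n n.*2.-1 u) x 1 ->
    rjacn alpha beta n u x = (jweight alpha beta x)^-1 * \sum_(1 <= k < n.+1) (-1) ^+ k *
      derive1n k (fun y => acoef alpha beta C k y * derive1n k u y) x) ->
  [/\ exists M, forall x, -1 < x < 1 ->
        `|rjac_flux alpha beta (rjacn alpha beta n.-1 u) x| <= M,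
      cvg (rquasi alpha beta n C u n.-1 x @[x --> (1 : R)^'-]) &
      cvg (rquasi alpha beta n C u n.-1 x @[x --> (-1 : R)^'+])].
Proof.
move=> n0 du acu ih HC; set w := jweight alpha beta in ih HC *.
have I1 : (-1 : R) < 1 by lra.
have du' k y : (k < n.*2.-1)%N -> -1 < y < 1 -> derivable (derive1n k u) y 1.
  by move=> kn; apply: du; lia.
have acu' k x y : (k <= n.*2.-1)%N -> -1 < x -> x < y -> y < 1 -> abs_cont x y (derive1n k u).
  by move=> kn; apply: acu; lia.
have ih' : mu.-integrable `](-1 : R), 1[ (EFin \o (fun x => - (w x * rjacn alpha beta n u x))).
  have := integrableN ih; by apply: eq_integrable => // x _ /=; rewrite ?EFinN.
have nE : (n.-1.*2.+1 = n.*2.-1)%N by lia.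
have dF : diffexp u n.*2.-1 (rjac_flux alpha beta (rjacn alpha beta n.-1 u)).
  by rewrite -nE; apply: (diffexp_rjac_flux _ _ du'); [lia|apply: (diffexp_rjacn _ _ du'); lia].
have dQ : diffexp u n.*2.-1 (rquasi alpha beta n C u n.-1).
  by have := diffexp_rquasi alpha beta du' C; move=> /(_ n n.-1 _ _)/(diffexp_le (N' := n.*2.-1)); apply; lia.
have acF := diffexp_abs_cont (leqnn _) acu' dF.
have acQ := diffexp_abs_cont (leqnn _) acu' dQ.
have acU x y := @acu n.*2.-1 x y ltac:(lia).
have [cF1 cF2] := abs_cont_cvg_endpoints I1 acU acF ih' (fun x xI _ => etrans
  (derive1_rjac_flux alpha beta (rjacn alpha beta n.-1 u) xI) (etrans (mulNr _ _)
  (congr1 (fun k => - (w x * rjacn alpha beta k u x)) (prednK n0)))).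
have [|cQ1 cQ2] := abs_cont_cvg_endpoints I1 acU acQ ih'.
- move=> x xI dU.
  have n1 : (n.-1 < n)%N by lia.
  have nK : (n + n.-1 <= n.*2.-1)%N by lia.
  rewrite (derive1_eq_itv (fun y yI => rquasi_sum alpha beta du' C n1 nK yI) xI).
  have -> : (n - n.-1 = 1)%N by lia.
  (* The term of index [i] has order 2i-1, which reaches 2n-1 for i = n: this is where
     differentiability of u^(2n-1) at [x] enters. *)
  have dterm i : (1 <= i < n.+1)%N -> derivable (derive1n (i - 1)
      (fun y => acoef alpha beta C i y * derive1n i u y)) x 1.
    move=> /andP[i1 iN].
    apply: (@diffexp_derivable_at _ u n.*2.-1 (i + (i - 1)) _ x xI _ du' dU); first lia.
    by apply: (diffexp_term alpha beta du'); lia.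
  rewrite (derive1_sum (f := fun i y => (-1) ^+ (i - 1) *
    derive1n (i - 1) (fun y => acoef alpha beta C i y * derive1n i u y) y) _).2; last first.
    move=> i; rewrite mem_index_iota => iN.
    by apply: derivable_mul; [exact: derivable_const|exact: dterm].
  rewrite HC// mulVKf; last by rewrite gt_eqF// jweight_gt0.
  rewrite -sumrN; apply: eq_big_nat => i iN.
  rewrite derive1_mul; [|exact: derivable_const|exact: dterm].
  rewrite derive1_const mul0r add0r -derive1nS.
  have [i' ->] : exists i', i = i'.+1 by exists i.-1; lia.
  by rewrite subn1 /= exprS mulN1r mulNr opprK.
split => //; exact: (bounded_of_cvg_endpoints I1 acF cF1 cF2).
Qed.

End endpoint_limits.

(** * Complex-valued functions *)

Local Open Scope complex_scope.

Section complex_parts.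
Context {R : realType}.
Implicit Types (a b x y r : R) (f g : R -> R[i]) (u v : R -> R) (z : R[i])
  (p : bool) (C : nat -> R) (k m n : nat).
Local Notation mu := (@lebesgue_measure R).

(** A boolean selector, so that each statement on real and imaginary parts is proved once. The
    operators have real coefficients and therefore commute with it. *)
Definition part p z : R := if p then complex.Im z else complex.Re z.

Lemma part0 p : part p 0 = 0. Proof. by case: p. Qed.

Lemma partD p : {morph part p : z z' / z + z'}.
Proof. by case: p => -[a b] [c d]. Qed.

Lemma partN p : {morph part p : z / - z}.
Proof. by case: p => -[a b]. Qed.

Lemma partB p : {morph part p : z z' / z - z'}.
Proof. by move=> z z'; rewrite partD partN. Qed.

Lemma part_realM p r z : part p (r%:C * z) = r * part p z.
Proof. by case: p; case: z => a b; rewrite /= mul0r ?subr0 ?addr0. Qed.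

Lemma part_sum p (I : Type) (s : seq I) (P : pred I) (F : I -> R[i]) :
  part p (\sum_(i <- s | P i) F i) = \sum_(i <- s | P i) part p (F i).
Proof. exact: (big_morph _ (partD p) (part0 p)). Qed.

Lemma part_signM p k z : part p ((-1) ^+ k * z) = (-1) ^+ k * part p z.
Proof.
have -> : (-1) ^+ k = ((-1) ^+ k : R)%:C by rewrite rmorphXn/= rmorphN1.
exact: part_realM.
Qed.

Lemma complex_parts z : z = part false z +i* part true z.
Proof. by case: z. Qed.

Lemma cderivableE f x : cderivable f x <-> forall p, derivable (part p \o f) x 1.
Proof. by split=> [[h1 h2] []//|h]; split; [exact: (h false)|exact: (h true)]. Qed.

Lemma part_cderiv p f : part p \o cderiv f = derive1 (part p \o f).
Proof. by case: p. Qed.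

Lemma part_cderivn p k f : part p \o cderivn k f = derive1n k (part p \o f).
Proof.
elim: k => [|k IH]; first by case: p.
by rewrite derive1nS -IH -part_cderiv.
Qed.

Lemma part_cderivnE p k f x : part p (cderivn k f x) = derive1n k (part p \o f) x.
Proof. by rewrite -part_cderivn. Qed.

Lemma part_realM_fun p u f :
  part p \o (fun y => (u y)%:C * f y) = (fun y => u y * (part p \o f) y).
Proof. by apply/funext => y /=; rewrite part_realM. Qed.

Variables alpha beta : R.

Lemma part_jacobi_expr p f :
  part p \o jacobi_expr alpha beta f = rjac alpha beta (part p \o f).
Proof.
apply/funext => x; rewrite /= /jacobi_expr /rjac.
rewrite mulNr partN part_realM mulNr; congr (- (_ * _)).
rewrite -[LHS]/((part p \o cderiv _) x) part_cderiv part_realM_fun.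
by rewrite -[X in derive1 X x = _]/(fun y => _ * (part p \o cderiv f) y) part_cderiv.
Qed.

Lemma part_jacobi_pow p m f :
  part p \o jacobi_pow alpha beta m f = rjacn alpha beta m (part p \o f).
Proof.
elim: m => [//|m IH].
transitivity (rjac alpha beta (part p \o jacobi_pow alpha beta m f)); last by rewrite IH.
exact: part_jacobi_expr.
Qed.

Lemma part_coef_cderivn p C k f :
  part p \o (fun y => (acoef alpha beta C k y)%:C * cderivn k f y) =
  (fun y => acoef alpha beta C k y * derive1n k (part p \o f) y).
Proof.
rewrite part_realM_fun; apply/funext => y; congr (_ * _).
by rewrite part_cderivn.
Qed.

Lemma part_quasi_upper p n C f k :
  part p \o quasi_upper alpha beta n C f k = rquasi alpha beta n C (part p \o f) k.
Proof.
elim: k => [|k IH]; first exact: part_coef_cderivn.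
apply/funext => x; rewrite /= partB part_realM part_cderivnE.
by congr (_ - _); rewrite -IH -part_cderiv.
Qed.

Lemma cmod_sqr z : cmod z ^+ 2 = part false z ^+ 2 + part true z ^+ 2.
Proof.
rewrite /cmod normc_def /= sqr_sqrtr//; last by rewrite addr_ge0// sqr_ge0.
Qed.

Lemma cmod_ge0 z : 0 <= cmod z.
Proof. by rewrite /cmod normc_def /= sqrtr_ge0. Qed.

Lemma part_le_cmod p z : `|part p z| <= cmod z.
Proof.
rewrite -ler_sqr ?nnegrE ?normr_ge0 ?cmod_ge0// real_normK ?num_real// cmod_sqr.
by case: p; rewrite ?lerDl ?lerDr sqr_ge0.
Qed.

Lemma abs_cont_of_ACloc p f x y : ACloc f -> -1 < x -> x < y -> y < 1 ->
  abs_cont x y (part p \o f).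
Proof.
move=> acf x1 xy y1 e /(acf x y x1 (ltW xy) y1)[d d0 Hd]; exists d => // s /andP[/allP fs ps] ss.
pose i0 : R * R := (0, 0).
have := Hd (size s) (fun i => (nth i0 s i).1) (fun i => (nth i0 s i).2) _ _ _.
have -> : \sum_(i < size s) ((nth i0 s i).2 - (nth i0 s i).1) = \sum_(q <- s) (q.2 - q.1).
  by rewrite (big_nth i0) big_mkord.
move=> H; apply: le_lt_trans (H _ _ _).
- rewrite (big_nth i0) big_mkord; apply: ler_sum => i _ /=.
  by rewrite -partB; exact: part_le_cmod.
- by move=> i si; have /andP[/andP[-> ->] ->] := fs _ (mem_nth i0 si).
- move=> i j si sj /eqP; rewrite neq_ltn => /orP[ij|ji].
    by have /orP := elimT (pairwiseP i0) ps i j si sj ij.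
  by have /orP[] := elimT (pairwiseP i0) ps j i sj si ji; [right|left].
- exact: ss.
Qed.

(** As alpha and beta are positive, the weight is bounded on (-1,1), so w + w |f|^2 is integrable;
    it dominates w |f| by t <= 1 + t^2. *)
Lemma L2_integrable p f : 0 < alpha -> 0 < beta -> L2 alpha beta f ->
  mu.-integrable `](-1 : R), 1[ (EFin \o (fun x => jweight alpha beta x * part p (f x))).
Proof.
move=> a0 b0 [mRe mIm fin].
have mw := jweight_measurable alpha beta.
have mp : measurable_fun `](-1 : R), 1[ (fun x => part p (f x)) by case: p.
have m2 : measurable_fun `](-1 : R), 1[ (fun x => cmod (f x) ^+ 2 * jweight alpha beta x).
  apply: measurable_funM => //.
  rewrite (_ : (fun x => _) = (fun x => part false (f x) ^+ 2 + part true (f x) ^+ 2)).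
    by apply: measurable_funD; exact: measurable_funX.
  by apply/funext => x; rewrite cmod_sqr.
have w0 x : -1 < x < 1 -> 0 <= jweight alpha beta x by move=> xI; rewrite ltW// jweight_gt0.
have i2 : mu.-integrable `](-1 : R), 1[ (fun x => (cmod (f x) ^+ 2 * jweight alpha beta x)%:E).
  apply/integrableP; split; first exact/measurable_EFinP.
  apply: le_lt_trans fin; rewrite le_eqVlt; apply/orP; left; apply/eqP.
  apply: eq_integral => x; rewrite inE /= in_itv/= => xI.
  by rewrite ger0_norm// mulr_ge0 ?sqr_ge0// w0.
pose B : R := 2 `^ alpha * 2 `^ beta.
have iB : mu.-integrable `](-1 : R), 1[ (EFin \o cst B).
  have := @continuous_compact_integrable R (cst B) `[(-1 : R), 1] (@segment_compact _ _ _).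
  have cB : {within `[(-1 : R), 1], continuous (cst B)} by apply: continuous_subspaceT => x; exact: cvg_cst.
  by move=> /(_ cB)/integrableS; apply => //; exact: subset_itv_oo_cc.
have := integrableD _ iB i2 => /(_ (measurable_itv _)).
apply: le_integrable => //.
  by apply/measurable_EFinP; exact: measurable_funM.
move=> x; rewrite /= in_itv/= => xI; rewrite lee_fin.
rewrite normrM (ger0_norm (w0 x xI)).
have wB : jweight alpha beta x <= B.
  rewrite /jweight /B; case/andP: xI => x1 x2.
  by apply: ler_pM; rewrite ?powR_ge0//; apply: ge0_ler_powR; rewrite ?nnegrE ?ltW//; lra.
have h1 : `|part p (f x)| <= 1 + cmod (f x) ^+ 2.
  apply: le_trans (part_le_cmod _ _) _; have := cmod_ge0 (f x); nra.
apply: le_trans (ler_wpM2l (w0 x xI) h1) _; apply: le_trans (ler_norm _).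
by rewrite mulrDr mulr1 [X in _ + X]mulrC lerD2r.
Qed.

End complex_parts.

(** * From real and imaginary parts back to complex functions *)

Section complex_endpoints.
Context {R : realType}.
Implicit Types (a b x y r : R) (f g : R -> R[i]) (F G u v : R -> R) (z : R[i])
  (p : bool) (C : nat -> R) (k m n : nat).

Lemma derive1n_eq_itv a b F G k : (forall y, a < y < b -> F y = G y) ->
  forall y, a < y < b -> derive1n k F y = derive1n k G y.
Proof.
by move=> FG; elim: k => [|k IH] y yab; [exact: FG|rewrite !derive1nS; exact: derive1_eq_itv IH yab].
Qed.

Lemma derive1n_0 k : derive1n k (fun=> 0 : R) = (fun=> 0).
Proof. by elim: k => // k IH; rewrite derive1nS IH derive1_const. Qed.

Lemma cderivn_real a b f v k : (forall y, a < y < b -> f y = (v y)%:C) ->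
  forall y, a < y < b -> cderivn k f y = (derive1n k v y)%:C.
Proof.
move=> fv y yab; rewrite (complex_parts (cderivn k f y)) !part_cderivnE.
rewrite (@derive1n_eq_itv a b (part false \o f) v)//; last by move=> t tab; rewrite /= fv.
rewrite (@derive1n_eq_itv a b (part true \o f) (fun=> 0))//; last by move=> t tab; rewrite /= fv.
by rewrite derive1n_0.
Qed.

(** Where [g] is real, conjugation acts trivially, and the form is linear in [f] with real
    coefficients, so it splits into parts. *)
Lemma part_sesq (alpha beta : R) a b p n C f g v x :
  (forall y, a < y < b -> g y = (v y)%:C) -> a < x < b ->
  part p (sesq alpha beta n C f g x) = rsesq alpha beta n C (part p \o f) v x.
Proof.
move=> gv xab; rewrite /sesq /rsesq part_sum; apply: eq_bigr => k _.
rewrite part_sum; apply: eq_bigr => j _.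
rewrite part_signM partB; congr (_ * (_ - _)).
  rewrite (@cderivn_real a b _ (fun y => acoef alpha beta C k y * derive1n k v y) _ _ _ xab).
    by rewrite part_realM part_cderivnE.
  move=> y yab; rewrite (@cderivn_real a b (fun y => (g y)^*) v _ _ _ yab) ?rmorphM//.
  by move=> t tab; rewrite gv// conjc_real.
rewrite (@cderivn_real a b (fun y => (g y)^*) v _ _ _ xab); last by move=> t tab; rewrite gv// conjc_real.
by rewrite [in LHS]mulrC part_realM mulrC part_cderivnE part_coef_cderivn.
Qed.

Lemma cvg_complex (Fl : set_system R) (FF : ProperFilter Fl) f (l : R[i]) :
  (forall p, part p (f x) @[x --> Fl] --> part p l) ->
  (f x : R[i]^o) @[x --> Fl] --> (l : R[i]^o).
Proof.
(* In the order of [R[i]] a positive number has imaginary part 0; half of its real part is allotted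
   to each component. *)
move=> cf; apply/cvgrPdist_lt => e; rewrite ltcE /= => /andP[/eqP e0 e1].
have e20 : 0 < complex.Re e / 2 by rewrite divr_gt0.
have /cvgrPdist_lt/(_ _ e20) c0 := cf false; have /cvgrPdist_lt/(_ _ e20) c1 := cf true.
near=> x.
have h0 : `|part false l - part false (f x)| < complex.Re e / 2 by near: x.
have h1 : `|part true l - part true (f x)| < complex.Re e / 2 by near: x.
move: h0 h1; rewrite -!partB; move: (l - f x) => z h0 h1.
rewrite normc_def ltcE /= e0 eqxx /=.
rewrite -[ltRHS]ger0_norm ?ltW// -sqrtr_sqr ltr_sqrt ?exprn_gt0//.
rewrite -[complex.Re z]/(part false z) -[complex.Im z]/(part true z).
rewrite -(real_normK (num_real (part false z))) -(real_normK (num_real (part true z))).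
have := normr_ge0 (part false z); have := normr_ge0 (part true z).
move: `|part false z| `|part true z| (complex.Re e) h0 h1 e1 => s t r hs ht r0 t0 s0.
nra.
Unshelve. all: by end_near. Qed.

(** The complex identity is applied to [u] viewed as a complex function with zero imaginary part,
    and the real part is taken. *)
Lemma real_jacobi_constants (alpha beta : R) n C u : (0 < n)%N ->
  jacobi_constants alpha beta n C ->
  (forall k y, (k.+1 < n.*2)%N -> -1 < y < 1 -> derivable (derive1n k u) y 1) ->
  forall x, -1 < x < 1 -> derivable (derive1n n.*2.-1 u) x 1 ->
    rjacn alpha beta n u x = (jweight alpha beta x)^-1 * \sum_(1 <= k < n.+1) (-1) ^+ k *
      derive1n k (fun y => acoef alpha beta C k y * derive1n k u y) x.
Proof.
move=> n0 hC du x xI dU; pose f := fun y => (u y)%:C.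
have pf : part false \o f = u by [].
have pt : part true \o f = (fun=> 0) by [].
have cd k y : derivable (derive1n k u) y 1 -> cderivable (cderivn k f) y.
  move=> d; apply/cderivableE => -[]; rewrite part_cderivn ?pf// pt derive1n_0.
  exact: derivable_const.
have := hC f x xI (fun k y kn yI => cd _ _ (du k y kn yI)) (cd _ _ dU).
move/(congr1 (part false)); rewrite part_realM part_sum.
rewrite -[X in X = _ -> _]/((part false \o jacobi_pow alpha beta n f) x) part_jacobi_pow pf => ->.
congr (_ * _); apply: eq_bigr => k _.
by rewrite part_signM part_cderivnE part_coef_cderivn pf.
Qed.

(** As s <= n, the order 2n-s is at least n and falls in the recursive branch, at depth n-s. *)
Lemma quasi_upperE (alpha beta : R) n C f s : (1 <= s <= n)%N ->
  quasi alpha beta n C f (n.*2 - s) = quasi_upper alpha beta n C f (n - s).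
Proof.
move=> sn; rewrite /quasi; have -> : (n.*2 - s < n)%N = false by lia.
by congr quasi_upper; lia.
Qed.

Lemma part_sign_real p k (r : R) z : part p ((-1) ^+ k * r%:C * z) = (-1) ^+ k * r * part p z.
Proof. by rewrite -mulrA part_signM part_realM mulrA. Qed.

End complex_endpoints.

Theorem lemma4p4 (R : realType) (alpha beta : R) (n : nat) (C : nat -> R)
    (phip phim : nat -> R -> R[i]) (f : R -> R[i]) (s : nat)
    (halpha : 0 < alpha < 1) (hbeta : 0 < beta < 1) (hn : (0 < n)%N)
    (hC : jacobi_constants alpha beta n C)
    (hphip : forall j : nat, (0 < j)%N -> phi_right j (phip j))
    (hphim : forall j : nat, (0 < j)%N -> phi_left j (phim j))
    (hf : Dmax alpha beta n f)
    (hs : (1 <= s <= n)%N) :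
  [/\ cvg_right (sesq alpha beta n C f (phip s)),
      cvg_right (quasi alpha beta n C f (n.*2 - s)) &
      lim_right (quasi alpha beta n C f (n.*2 - s)) =
        (-1) ^+ s / (s.-1)`!%:R
          * lim_right (sesq alpha beta n C f (phip s))] /\
  [/\ cvg_left (sesq alpha beta n C f (phim s)),
      cvg_left (quasi alpha beta n C f (n.*2 - s)) &
      - lim_left (quasi alpha beta n C f (n.*2 - s)) =
        1 / (s.-1)`!%:R * lim_left (sesq alpha beta n C f (phim s))].
Proof.
have [a0 _] := andP halpha; have [b0 _] := andP hbeta.
have I1 : (-1 : R) < 1 by lra.
have [_ df acf hL2] := hf.
have du p k y : (k.+1 < n.*2)%N -> -1 < y < 1 -> derivable (derive1n k (part p \o f)) y 1.
  by move=> kn yI; rewrite -part_cderivn; have /cderivableE := df k y kn yI; apply.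
have acu p k x y : (k < n.*2)%N -> -1 < x -> x < y -> y < 1 ->
    abs_cont x y (derive1n k (part p \o f)).
  by move=> kn; rewrite -part_cderivn; apply: abs_cont_of_ACloc; exact: acf.
have ih p : (@lebesgue_measure R).-integrable `](-1 : R), 1[
    (EFin \o (fun x => jweight alpha beta x * rjacn alpha beta n (part p \o f) x)).
  by rewrite -part_jacobi_pow; exact: L2_integrable.
have ends p := flux_quasi_endpoints hn (du p) (acu p) (ih p)
  (real_jacobi_constants hn hC (du p)).
have s0 : (0 < s)%N by case/andP: hs.
have fact0 : (s.-1)`!%:R != 0 :> R[i] by rewrite pnatr_eq0 -lt0n fact_gt0.
have factC : (s.-1)`!%:R = ((s.-1)`!%:R : R)%:C by rewrite rmorph_nat.
rewrite quasi_upperE//; split.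
  have [_ phi1 _] := hphip s s0.
  have [c /andP[_ c1] Hc] := at_left_witness I1 phi1.
  have core p : exists L, part p (quasi_upper alpha beta n C f (n - s) x) @[x --> (1 : R)^'-] --> L /\
      part p (sesq alpha beta n C f (phip s) x) @[x --> (1 : R)^'-] --> (-1) ^+ s * (s.-1)`!%:R * L.
    have [[M HM] cQ _] := ends p.
    have HM' : exists M, forall x, 0 < x < 1 ->
        `|rjac_flux alpha beta (rjacn alpha beta n.-1 (part p \o f)) x| <= M.
      by exists M => x /andP[x0 x1]; apply: HM; apply/andP; split; lra.
    have [L [qL sL]] := cvg_quasi_sesq_at_one a0 hs (du p) HM' cQ.
    exists L; split; first by rewrite -part_quasi_upper in qL.
    (* On ]c,1[ the cut-off function is the monomial itself, so both forms agree near 1. *)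
    move: sL; apply: cvg_trans; apply: near_eq_cvg; near=> x.
    rewrite (@part_sesq R alpha beta c 1 p n C f (phip s) (fun y => (1 - y) ^+ s.-1))//.
    by apply/andP; split; near: x; [exact: nbhs_left_gt|exact: nbhs_left_lt].
  have [L0 [q0 e0]] := core false; have [L1 [q1 e1]] := core true.
  pose L := L0 +i* L1.
  have cq : (quasi_upper alpha beta n C f (n - s) x : R[i]^o) @[x --> (1 : R)^'-] --> (L : R[i]^o).
    by apply: cvg_complex => -[].
  have cs : (sesq alpha beta n C f (phip s) x : R[i]^o) @[x --> (1 : R)^'-] -->
      ((-1) ^+ s * (s.-1)`!%:R * L : R[i]^o).
    by apply: cvg_complex => p; rewrite factC part_sign_real; case: p.
  split; [exact: cvgP cs|exact: cvgP cq|].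
  rewrite /lim_right (cvg_lim _ cq)// (cvg_lim _ cs)//.
  (* The sign (-1)^s is its own inverse, so solving for the quasi-derivative keeps it and inverts
     only the factorial. *)
  by rewrite mulrA mulrACA -expr2 sqrr_sign mulVf// !mul1r.
have [_ phi1 _] := hphim s s0.
have [c /andP[c1 _] Hc] := at_right_witness I1 phi1.
have core p : exists L, part p (quasi_upper alpha beta n C f (n - s) x) @[x --> (-1 : R)^'+] --> L /\
    part p (sesq alpha beta n C f (phim s) x) @[x --> (-1 : R)^'+] --> - (s.-1)`!%:R * L.
  have [[M HM] _ cQ] := ends p.
  have HM' : exists M, forall x, -1 < x < 0 ->
      `|rjac_flux alpha beta (rjacn alpha beta n.-1 (part p \o f)) x| <= M.
    by exists M => x /andP[x0 x1]; apply: HM; apply/andP; split; lra.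
  have [L [qL sL]] := cvg_quasi_sesq_at_minus_one b0 hs (du p) HM' cQ.
  exists L; split; first by rewrite -part_quasi_upper in qL.
  move: sL; apply: cvg_trans; apply: near_eq_cvg; near=> x.
  rewrite (@part_sesq R alpha beta (-1) c p n C f (phim s) (fun y => (1 + y) ^+ s.-1))//.
  by apply/andP; split; near: x; [exact: nbhs_right_gt|exact: nbhs_right_lt].
have [L0 [q0 e0]] := core false; have [L1 [q1 e1]] := core true.
pose L := L0 +i* L1.
have cq : (quasi_upper alpha beta n C f (n - s) x : R[i]^o) @[x --> (-1 : R)^'+] --> (L : R[i]^o).
  by apply: cvg_complex => -[].
have cs : (sesq alpha beta n C f (phim s) x : R[i]^o) @[x --> (-1 : R)^'+] -->
    (- (s.-1)`!%:R * L : R[i]^o).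
  by apply: cvg_complex => p; rewrite factC mulNr partN part_realM -mulNr; case: p.
split; [exact: cvgP cs|exact: cvgP cq|].
rewrite /lim_left (cvg_lim _ cq)// (cvg_lim _ cs)//.
by rewrite mulNr mulrN mulrA mul1r mulVf// mul1r.
Unshelve. all: by end_near. Qed.
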